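(* Let $X=\{X_t,\ t\in[0,T]\}$ be a Lévy process with moments of all orders. For every $A\in\mathcal B([0,T])$ and $n\ge1$, $$\boldsymbol\Delta_n(A)=\phi_n(A),$$ where $\boldsymbol\Delta_n(A)=\phi^{\otimes n}(A^n_{\widehat1})$ is the diagonal measure of order $n$ of $\phi$, and $\phi_n$ is the random measure induced by $X^{(n)}$.
   Context: $(\Omega,\mathcal F,\mathbb P)$ is a complete probability space, $T>0$, and $X=\{X_t,\ t\in[0,T]\}$ is a real Lévy process (stationary independent increments, continuous in probability, cadlag, $X_0=0$) with moments of all orders; $\sigma_G^2$ is the variance of its Gaussian part. Its variations are $X^{(1)}_t=X_t$, $X^{(2)}_t=[X,X]_t=\sum_{0<s\le t}(\Delta X_s)^2+\sigma_G^2t$, $X^{(n)}_t=\sum_{0<s\le t}(\Delta X_s)^n$ for $n\ge3$. A random measure is a $\sigma$-additive $L^2(\Omega)$-valued vector measure. $\phi_n$ is the random measure on $\mathcal B([0,T])$ induced by $X^{(n)}$: $\phi_n((s,t])=X^{(n)}_t-X^{(n)}_s$, $\phi_n(\{0\})=0$; $\phi=\phi_1$. It is known that there is a unique random measure $\phi^{\otimes n}$ on $\mathcal B([0,T]^n)$ with $\phi^{\otimes n}(A_1\times\cdots\times A_n)=\prod_i\phi(A_i)$. For $A\subset[0,T]$, $A^n_{\widehat1}=\{(s_1,\dots,s_n)\in A^n: s_1=\cdots=s_n\}$. *)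

(* Defs.v *)
From HB Require Import structures.
From mathcomp Require Import all_boot all_order all_algebra.
From mathcomp Require Import all_classical all_reals all_analysis.

Set Implicit Arguments.
Unset Strict Implicit.
Unset Printing Implicit Defensive.
Import Order.TTheory GRing.Theory Num.Theory.
Import numFieldNormedType.Exports.

Local Open Scope classical_set_scope.
Local Open Scope ring_scope.

(* Time runs through [0, T]: a process is a function R -> Omega -> R of which
   only the restriction to [0, T] matters. *)

(* Subfamilies need no separate clause: take B i = setT. *)
Definition independent_rvs (d : measure_display) (Omega : measurableType d)
    (R : realType) (P : probability Omega R) (k : nat)
    (Y : 'I_k -> Omega -> R) : Prop :=
  forall B : 'I_k -> set (measurableTypeR R), (forall i, measurable (B i)) ->
    P (\bigcap_i (Y i @^-1` B i)) = (\prod_(i < k) P (Y i @^-1` B i))%E.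

Definition cadlag (R : realType) (T : R) (x : R -> R) : Prop :=
  (forall t : R, 0 <= t < T -> x u @[u --> t^'+] --> x t) /\
  (forall t : R, 0 < t <= T -> cvg (x u @[u --> t^'-])).

Record levy_process (d : measure_display) (Omega : measurableType d)
    (R : realType) (P : probability Omega R) (T : R) (X : R -> Omega -> R)
    : Prop := LevyProcess {
  levy_measurable : forall t : R, 0 <= t <= T -> measurable_fun setT (X t) ;
  levy_start : \forall w \ae P, X 0 w = 0 ;
  levy_independent : forall (k : nat) (t : nat -> R),
    0 <= t 0%N -> (forall i, (i < k)%N -> t i <= t i.+1) -> t k <= T ->
    independent_rvs P (fun i : 'I_k => X (t i.+1) \- X (t i)) ;
  levy_stationary : forall s t : R, 0 <= s -> s <= t -> t <= T ->
    forall B : set (measurableTypeR R), measurable B ->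
      P ((X t \- X s) @^-1` B) = P (X (t - s) @^-1` B) ;
  levy_stochastically_continuous : forall t : R, 0 <= t <= T ->
    forall e : R, 0 < e ->
      P [set w | e < `|X s w - X t w|] @[s --> within `[0, T]%classic (nbhs t)]
        --> 0%E ;
  levy_cadlag : \forall w \ae P, cadlag T (X ^~ w) }.

Definition moments_of_all_orders (d : measure_display)
    (Omega : measurableType d) (R : realType) (P : probability Omega R)
    (T : R) (X : R -> Omega -> R) : Prop :=
  forall t : R, 0 <= t <= T -> forall k : nat,
    P.-integrable setT (EFin \o (fun w => X t w ^+ k)).

Definition levy_measure (R : realType)
    (nu : {measure set (measurableTypeR R) -> \bar R}) : Prop :=
  nu [set 0] = 0%E /\
  (\int[nu]_x (Num.min 1 (x ^+ 2))%:E < +oo)%E.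

(* Real and imaginary parts of the Levy-Khintchine exponent
   i g u - s2 u^2 / 2 + \int (e^{iux} - 1 - i u x 1_{|x| <= 1}) nu(dx). *)
Definition levy_exponent_re (R : realType) (s2 : R)
    (nu : {measure set (measurableTypeR R) -> \bar R}) (u : R) : R :=
  - (s2 * u ^+ 2 / 2) + Rintegral nu setT (fun x => cos (u * x) - 1).

Definition levy_exponent_im (R : realType) (g : R)
    (nu : {measure set (measurableTypeR R) -> \bar R}) (u : R) : R :=
  g * u + Rintegral nu setT
    (fun x => sin (u * x) - (if `|x| <= 1 then u * x else 0)).

(* s2 is the Gaussian coefficient of the characteristic triplet (g, s2, nu) of
   X, i.e. E[e^{iuX_t}] = e^{t psi(u)} for 0 <= t <= T; the real and imaginary
   parts of this identity are stated separately. *)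
Definition gaussian_variance (d : measure_display) (Omega : measurableType d)
    (R : realType) (P : probability Omega R) (T : R) (X : R -> Omega -> R)
    (s2 : R) : Prop :=
  0 <= s2 /\
  exists (g : R) (nu : {measure set (measurableTypeR R) -> \bar R}),
    levy_measure nu /\
    forall t u : R, 0 <= t <= T ->
      ('E_P[fun w => cos (u * X t w)] =
        (expR (t * levy_exponent_re s2 nu u) *
         cos (t * levy_exponent_im g nu u))%:E)%E /\
      ('E_P[fun w => sin (u * X t w)] =
        (expR (t * levy_exponent_re s2 nu u) *
         sin (t * levy_exponent_im g nu u))%:E)%E.

Definition jump (R : realType) (x : R -> R) (s : R) : R :=
  x s - lim (x u @[u --> s^'-]).

(* Sum of an absolutely summable real family over an arbitrary index set. *)
Definition rsum (R : realType) (I : choiceType) (D : set I) (f : I -> R) : R :=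
  fine (\esum_(i in D) ((EFin \o f)^\+ i))%E -
  fine (\esum_(i in D) ((EFin \o f)^\- i))%E.

(* The n-th variation X^(n), meaningful for n >= 1. *)
Definition levy_variation (Omega : Type) (R : realType) (X : R -> Omega -> R)
    (s2 : R) (n : nat) (t : R) (w : Omega) : R :=
  let jumps := rsum `]0, t]%classic (fun s : R => jump (X ^~ w) s ^+ n) in
  match n with
  | 1 => X t w
  | 2 => jumps + s2 * t
  | _ => jumps
  end.

(* L^2(Omega)-valued measure on the measurable subsets of E; elements of
   L^2(Omega) are represented by functions, up to P-a.e. equality. *)
Record random_measure (d : measure_display) (Omega : measurableType d)
    (R : realType) (P : probability Omega R) (d' : measure_display)
    (S : measurableType d') (E : set S) (phi : set S -> Omega -> R)
    : Prop := RandomMeasure {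
  random_measure_L2 : forall A, measurable A -> A `<=` E ->
    phi A \in Lfun P 2%:E ;
  random_measure_sigma_additive : forall F : nat -> set S,
    (forall i, measurable (F i)) -> (forall i, F i `<=` E) ->
    trivIset setT F ->
    ('N[P]_2%:E [EFin \o (fun w =>
       \sum_(i < m) phi (F i) w - phi (\bigcup_i F i) w)%R])%E @[m --> \oo]
      --> 0%E }.

Definition induced_measure (d : measure_display) (Omega : measurableType d)
    (R : realType) (P : probability Omega R) (T : R) (Y : R -> Omega -> R)
    (phi : set (measurableTypeR R) -> Omega -> R) : Prop :=
  [/\ random_measure P (`[0, T]%classic : set (measurableTypeR R)) phi,
      forall s t : R, 0 <= s -> s <= t -> t <= T ->
        \forall w \ae P, phi `]s, t]%classic w = Y t w - Y s w &
      \forall w \ae P, phi [set 0] w = 0].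

Definition box (S : Type) (n : nat) (A : 'I_n -> set S) : set (n.-tuple S) :=
  [set x | forall i, A i (tnth x i)].

Definition tensor_power (d : measure_display) (Omega : measurableType d)
    (R : realType) (P : probability Omega R) (T : R)
    (phi : set (measurableTypeR R) -> Omega -> R) (n : nat)
    (Phi : set (n.-tuple (measurableTypeR R)) -> Omega -> R) : Prop :=
  random_measure P
    (box (fun=> `[0, T]%classic : set (measurableTypeR R))) Phi /\
  forall A : 'I_n -> set (measurableTypeR R),
    (forall i, measurable (A i)) -> (forall i, A i `<=` `[0, T]%classic) ->
    \forall w \ae P, Phi (box A) w = \prod_(i < n) phi (A i) w.

Definition tuple_diagonal (S : Type) (n : nat) (A : set S) : set (n.-tuple S) :=
  [set x | box (fun=> A) x /\ forall i j, tnth x i = tnth x j].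

Definition diagonal_measure (Omega S : Type) (R : realType) (n : nat)
    (Phi : set (n.-tuple S) -> Omega -> R) (A : set S) : Omega -> R :=
  Phi (@tuple_diagonal S n A).

(* Main.v *)
Require Import Defs.
From HB Require Import structures.
From mathcomp Require Import all_boot all_order all_algebra finmap.
From mathcomp Require Import all_classical all_reals all_analysis.
From mathcomp Require Import measurable_realfun.
From mathcomp Require Import ring lra zify.
Set Implicit Arguments.
Unset Strict Implicit.
Unset Printing Implicit Defensive.
Import Order.TTheory GRing.Theory Num.Theory.
Import numFieldNormedType.Exports.
Local Open Scope classical_set_scope.
Local Open Scope ring_scope.

(** Let [S_m(f)] be the sum of [f (X_{t_{i+1}} - X_{t_i})] over the dyadic
    partition of [(0, t]] of mesh [t / 2^m]. The unions of boxes
    [(t_i, t_{i+1}]^n] decrease to the diagonal of [(0, t]^n], so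
    sigma-additivity of the tensor power gives [S_m(y^n) --> Delta_n((0, t])]
    in L^2, hence a.e. along a subsequence [m_k].

    Fix a cadlag path along which [S_{m_k}(y^2)] converges to some [Q]. If
    [f (y) = o(y^2)] at [0], then [S_{m_k}(f)] converges to the sum of
    [f (Delta X_s)]: finitely many large jumps contribute their own terms, and
    all other increments are uniformly small. For [f = y^n] with [n >= 3] this
    is the result.

    For [n = 2] it remains to see that [Q - \sum (Delta X_s)^2 = sigma^2 t].
    Taking [f (y) = 1 - cos (u y) - u^2 y^2 / 2] shows that
    [(2 / u^2) S_{m_k}(1 - cos (u .))] tends, as [k --> oo] and then
    [u --> oo], to [Q - \sum (Delta X_s)^2]. The increments are i.i.d., so the
    mean of these sums converges to [- (2 t / u^2) Re psi(u)], which tends to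
    [sigma^2 t] by the Levy-Khintchine formula, whereas their variance is
    O(1 / u^2); Fatou's lemma identifies the limit. A pi-lambda argument
    passes from the intervals [(0, t]] to all Borel sets. *)

(** * Finite approximation of absolutely convergent sums *)

(** Finite subsets are duplicate-free lists, so that partial sums are plain big sums and the
    intervals met by [F] can be listed with [map]. *)
Definition finsub (I : choiceType) (D : set I) (F : seq I) : Prop :=
  uniq F /\ forall i, i \in F -> D i.

Lemma finsub_undup_cat (I : choiceType) (D : set I) (F G : seq I) :
  finsub D F -> finsub D G -> finsub D (undup (F ++ G)).
Proof.
move=> [_ FD] [_ GD]; split; first exact: undup_uniq.
by move=> i; rewrite mem_undup mem_cat => /orP[/FD|/GD].
Qed.

(** Unconditional convergence: [F0] has a partial sum within [e] of the supremum, and the sum over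
    any larger [F] is trapped between the two. The bound [K] makes the extended sum finite, so
    [fine] loses nothing. *)
Lemma finsub_esum_approx (R : realType) (I : choiceType) (D : set I)
    (g : I -> R) (K : R) :
  (forall i, 0 <= g i) ->
  (forall F, finsub D F -> \sum_(i <- F) g i <= K) ->
  forall e : R, 0 < e -> exists2 F0, finsub D F0 &
    forall F, finsub D F -> {subset F0 <= F} ->
      `|\sum_(i <- F) g i - fine (\esum_(i in D) (g i)%:E)| <= e.
Proof.
move=> g0 gK e e0.
have sE F : finsub D F ->
    (\sum_(x \in [set` F]) (g x)%:E)%E = (\sum_(i <- F) g i)%:E.
  by move=> [uF FD]; rewrite -fsbig_seq// sumEFin.
have le_esum F : finsub D F ->
    ((\sum_(i <- F) g i)%:E <= \esum_(i in D) (g i)%:E)%E.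
  move=> FD; apply: esum_ge; exists [set` F].
    by split; [exact: finite_seq|move=> i /= ?; exact: FD.2].
  by rewrite sE.
have setE A : fsets D A -> exists2 F, finsub D F & A = [set` F].
  move=> [finA AD]; exists (fset_set A); last by rewrite fset_setK.
  by split; [exact: fset_uniq|move=> i; rewrite in_fset_set// inE => /AD].
have esumK : (\esum_(i in D) (g i)%:E <= K%:E)%E.
  apply: ub_ereal_sup => _ [A DA <-].
  by have [F DF ->] := setE _ DA; rewrite sE// lee_fin gK.
have esum0 : (0 <= \esum_(i in D) (g i)%:E)%E.
  by apply: esum_ge0 => i _; rewrite lee_fin.
have esumfin : \esum_(i in D) (g i)%:E \is a fin_num.
  by rewrite ge0_fin_numE// (le_lt_trans esumK)// ltry.
have [x [A DA <-] ltx] : exists2 x, [set (\sum_(x \in A) (g x)%:E)%E | A in fsets D] x &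
    (\esum_(i in D) (g i)%:E - e%:E < x)%E.
  exact: ub_ereal_sup_adherent.
have [F0 DF0 A0] := setE _ DA; exists F0 => // F DF sF.
have := le_esum _ DF; move: ltx; rewrite A0 sE//.
rewrite -(fineK esumfin) -EFinB lte_fin lee_fin => lt1 le1.
have le01 : \sum_(i <- F0) g i <= \sum_(i <- F) g i.
  rewrite [leRHS](bigID (mem F0))/= ler_wpDr//; first exact: sumr_ge0.
  rewrite -[leRHS]big_filter le_eqVlt; apply/orP; left; apply/eqP; apply: perm_big.
  apply: uniq_perm; [exact: DF0.1|by rewrite filter_uniq// DF.1|].
  by move=> i; rewrite mem_filter; case: (boolP (i \in F0)) => //= /sF ->.
rewrite ler_distl; apply/andP; split; lra.
Qed.

(** The positive and negative parts are both dominated by the absolute value of [f], so the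
    nonnegative case applies to each with [e / 2]; the union of the two finite sets serves for the
    difference. *)
Lemma rsum_approx (R : realType) (I : choiceType) (D : set I)
    (f : I -> R) (K : R) :
  (forall F, finsub D F -> \sum_(i <- F) `|f i| <= K) ->
  forall e : R, 0 < e -> exists2 F0, finsub D F0 &
    forall F, finsub D F -> {subset F0 <= F} ->
      `|\sum_(i <- F) f i - rsum D f| <= e.
Proof.
move=> fK e e0.
have posE : (fun i => (EFin \o f)^\+ i)%E = (fun i => (Num.max (f i) 0)%:E).
  by apply/funext => i; rewrite funeposE /= EFin_max.
have negE : (fun i => (EFin \o f)^\- i)%E = (fun i => (Num.max (- f i) 0)%:E).
  by apply/funext => i; rewrite funenegE /= EFin_max.
have [|||F1 DF1 H1] := @finsub_esum_approx R I D (fun i => Num.max (f i) 0) K _ _ (e / 2).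
- by move=> i; rewrite le_max lexx orbT.
- move=> F DF; apply: le_trans (fK F DF); apply: ler_sum => i _.
  by rewrite ge_max ler_norm normr_ge0.
- by rewrite divr_gt0.
have [|||F2 DF2 H2] := @finsub_esum_approx R I D (fun i => Num.max (- f i) 0) K _ _ (e / 2).
- by move=> i; rewrite le_max lexx orbT.
- move=> F DF; apply: le_trans (fK F DF); apply: ler_sum => i _.
  by rewrite ge_max -normrN ler_norm normr_ge0.
- by rewrite divr_gt0.
exists (undup (F1 ++ F2)); first exact: finsub_undup_cat.
move=> F DF sF.
have {}H1 := H1 _ DF ltac:(move=> i iF; apply: sF; rewrite mem_undup mem_cat iF //).
have {}H2 := H2 _ DF ltac:(move=> i iF; apply: sF; rewrite mem_undup mem_cat iF orbT //).
rewrite /rsum posE negE.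
have -> : \sum_(i <- F) f i =
    \sum_(i <- F) Num.max (f i) 0 - \sum_(i <- F) Num.max (- f i) 0.
  rewrite -sumrB; apply: eq_bigr => i _.
  by case: (leP (f i) 0) => fi; case: (leP (- f i) 0) => fi'; lra.
move: H1 H2; rewrite !ler_norml => /andP[? ?] /andP[? ?].
by apply/andP; split; lra.
Qed.

(** * Dyadic sums along a cadlag path *)

Lemma cadlag_right (R : realType) (T : R) (x : R -> R) (r e : R) :
  cadlag T x -> 0 <= r <= T -> 0 < e ->
  exists2 h : R, 0 < h & forall u, r <= u -> u <= T -> u < r + h ->
    `|x u - x r| < e.
Proof.
move=> [cr _] /andP[r0 rT] e0.
have [rT'|Tr] := ltP r T; last first.
  exists 1 => // u ru uT _; have -> : u = r by lra.
  by rewrite subrr normr0.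
have /cvgrPdist_lt/(_ e e0) := cr r (introT andP (conj r0 rT')).
move=> -[h /= h0 H]; exists h => // u ru uT uh.
have [->|ur] := eqVneq u r; first by rewrite subrr normr0.
have {}ur : r < u by rewrite lt_neqAle eq_sym ur.
rewrite distrC; apply: H => //=.
by rewrite ltr_distlC; lra.
Qed.

(** By the definition of [jump], [x r - jump x r] is the left limit at [r]. *)
Lemma cadlag_left (R : realType) (T : R) (x : R -> R) (r e : R) :
  cadlag T x -> 0 < r <= T -> 0 < e ->
  exists2 h : R, 0 < h & forall u, r - h < u -> u < r ->
    `|x u - (x r - jump x r)| < e.
Proof.
move=> [_ cl] r0T e0.
have /cvgrPdist_lt/(_ e e0) := cl r r0T.
move=> -[h /= h0 H]; exists h => // u rhu ur.
rewrite distrC /jump subKr; apply: H => //=.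
by rewrite ltr_distlC; lra.
Qed.

(** * Dyadic partitions and the increments along them *)

Definition dyadic (R : realType) (t : R) (m i : nat) : R := t * i%:R / 2 ^+ m.

Definition dyadic_incr (R : realType) (x : R -> R) (t : R) (m i : nat) : R :=
  x (dyadic t m i.+1) - x (dyadic t m i).

Definition dyadic_sum (R : realType) (f x : R -> R) (t : R) (m : nat) : R :=
  \sum_(0 <= i < 2 ^ m) f (dyadic_incr x t m i).

Lemma dyadicS (R : realType) (t : R) (m i : nat) :
  dyadic t m i.+1 = dyadic t m i + t / 2 ^+ m.
Proof. by rewrite /dyadic -natr1 mulrDr mulr1 mulrDl. Qed.

Lemma dyadic0 (R : realType) (t : R) (m : nat) : dyadic t m 0 = 0.
Proof. by rewrite /dyadic mulr0 mul0r. Qed.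

Lemma dyadic_last (R : realType) (t : R) (m : nat) : dyadic t m (2 ^ m) = t.
Proof. by rewrite /dyadic natrX mulfK// expf_neq0. Qed.

Lemma dyadic_le (R : realType) (t : R) (m i j : nat) :
  0 <= t -> (i <= j)%N -> dyadic t m i <= dyadic t m j.
Proof.
by move=> t0 ij; rewrite ler_pM2r ?invr_gt0 ?exprn_gt0// ler_wpM2l// ler_nat.
Qed.

Lemma dyadic_ge0 (R : realType) (t : R) (m i : nat) :
  0 <= t -> 0 <= dyadic t m i.
Proof. by move=> t0; rewrite -(dyadic0 t m) dyadic_le. Qed.

Lemma dyadic_bound (R : realType) (t : R) (m i : nat) :
  0 <= t -> (i <= 2 ^ m)%N -> dyadic t m i <= t.
Proof. by move=> t0 im; rewrite -[leRHS](dyadic_last t m) dyadic_le. Qed.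

Lemma dyadic_mesh (R : realType) (t h : R) :
  0 < h -> \forall m \near \oo, t / 2 ^+ m < h.
Proof.
move=> h0.
have : (fun m => t / 2 ^+ m) @ \oo --> (0 : R).
  have -> : (fun m => t / 2 ^+ m) = geometric t (2^-1 : R).
    by apply/funext => m /=; rewrite exprVn.
  by apply: cvg_geometric; rewrite ger0_norm ?invr_ge0// invf_lt1 ?ltr1n.
move/cvgrPdist_lt => /(_ h h0); apply: filterS => m.
by rewrite sub0r normrN; exact: le_lt_trans (ler_norm _).
Qed.

(** The least index whose dyadic point reaches [s] is positive since [0 < s]; its predecessor is the
    index sought. *)
Lemma dyadic_index (R : realType) (t s : R) (m : nat) :
  0 < s <= t ->
  exists2 i, (i < 2 ^ m)%N & dyadic t m i < s <= dyadic t m i.+1.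
Proof.
move=> /andP[s0 st].
have ex : exists i, s <= dyadic t m i by exists (2 ^ m)%N; rewrite dyadic_last.
case: (ex_minnP ex) => -[|i]; first by rewrite dyadic0 leNgt s0.
move=> si imin; exists i.
  by apply: imin; rewrite dyadic_last.
by rewrite si andbT ltNge; apply/negP => /imin; rewrite ltnn.
Qed.

(** The half-open form matters: the right end tends to [s] from above, where right continuity gives
    [x s], while the left end stays strictly below [s] and yields the left limit. *)
Lemma dyadic_incr_jump (R : realType) (T t s : R) (x : R -> R)
    (i : nat -> nat) :
  cadlag T x -> t <= T -> 0 < s <= t ->
  (forall m, (i m < 2 ^ m)%N) ->
  (forall m, dyadic t m (i m) < s <= dyadic t m (i m).+1) ->
  dyadic_incr x t m (i m) @[m --> \oo] --> jump x s.
Proof.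
move=> cx tT /andP[s0 st] im ism; apply/cvgrPdist_lt => e e0.
have e20 : 0 < e / 2 by rewrite divr_gt0.
have [|h h0 H] := @cadlag_right _ T x s (e / 2) cx _ e20.
  by rewrite (ltW s0) (le_trans st).
have [|k k0 K] := @cadlag_left _ T x s (e / 2) cx _ e20.
  by rewrite s0 (le_trans st).
have t0 : 0 <= t by lra.
near=> m; have /andP[is1 is2] := ism m.
have mh : t / 2 ^+ m < h by near: m; exact: dyadic_mesh.
have mk : t / 2 ^+ m < k by near: m; exact: dyadic_mesh.
have iT := dyadic_bound t0 (im m).
have iS := dyadicS t m (i m).
have {}H := H _ is2 (le_trans iT tT) ltac:(lra).
have {}K := K (dyadic t m (i m)) ltac:(lra) is1.
rewrite /dyadic_incr; move: H K; rewrite !ltr_norml.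
by move=> /andP[? ?] /andP[? ?]; apply/andP; split; lra.
Unshelve. all: by end_near. Qed.

(* Compactness: each [r] has a neighbourhood on which [x] oscillates little on
   either side of [r]. *)
Lemma cadlag_small_incr (R : realType) (T t dlt : R) (x : R -> R) (F : seq R) :
  cadlag T x -> 0 <= t <= T -> 0 < dlt ->
  (forall s, 0 < s <= t -> s \notin F -> `|jump x s| < dlt) ->
  \forall m \near \oo, forall i, (i < 2 ^ m)%N ->
    (forall s, s \in F -> ~~ (dyadic t m i < s <= dyadic t m i.+1)) ->
    `|dyadic_incr x t m i| < 2 * dlt.
Proof.
move=> cx /andP[t0 tT] d0 Fj.
(* [P] allows any interval starting at [a] of length at most the mesh, so that it is a property of
   real points [a], to which the compactness of [[0, t]] applies. *)
pose P m a := 0 <= a -> forall b, a <= b -> b <= a + t / 2 ^+ m -> b <= t ->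
  (forall s, s \in F -> ~~ (a < s <= b)) -> `|x b - x a| < 2 * dlt.
suff : \forall m \near \oo, `[0, t]%classic `<=` P m.
  apply: filterS => m Pm i im Fi.
  have ti := dyadic_bound t0 im.
  have ii := dyadic_le m t0 (leqnSn i).
  apply: Pm => //=; first by rewrite in_itv/= dyadic_ge0//= (le_trans ii).
  - exact: dyadic_ge0.
  - by rewrite dyadicS.
have /compact_near_coveringP cov := @segment_compact R 0 t.
apply: cov => r /=; rewrite in_itv/= => /andP[r0 rt].
have d20 : 0 < dlt / 2 by rewrite divr_gt0.
have [|h h0 H] := @cadlag_right _ T x r (dlt / 2) cx _ d20.
  by rewrite r0 (le_trans rt).
have [k k0 K] : exists2 k : R, 0 < k & 0 < r -> forall u, r - k < u -> u < r ->
    `|x u - (x r - jump x r)| < dlt / 2.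
  have [r0'|r0'] := ltP 0 r; last by exists 1 => //; lra.
  have [|k k0 K] := @cadlag_left _ T x r (dlt / 2) cx _ d20.
    by rewrite r0' (le_trans rt).
  by exists k.
near=> a m => /=; rewrite /P => a0 b ab bm bt Fab.
have mh : t / 2 ^+ m < h / 2 by near: m; apply: dyadic_mesh; rewrite divr_gt0.
have /andP[ak ah] : r - k < a < r + h / 2.
  near: a; apply: near_in_itvoo; rewrite in_itv/=; apply/andP; split; lra.
(* If both ends lie on the same side of [r], one of the two bounds is used twice. If [r] lies
   between them it is not in [F], so its jump adds less than [dlt]; hence the factor [2]. *)
have [ra|ar] := leP r a.
  have Ha := H a ra ltac:(lra) ltac:(lra).
  have Hb := H b ltac:(lra) ltac:(lra) ltac:(lra).
  move: Ha Hb; rewrite !ltr_norml => /andP[? ?] /andP[? ?]; apply/andP; split; lra.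
have r0' : 0 < r by lra.
have Ka := K r0' a ak ar.
have [rb|br] := leP r b.
  have rF : r \notin F.
    by apply/negP => /Fab; rewrite ar rb.
  have Jr := Fj r ltac:(lra) rF.
  have Hb := H b rb ltac:(lra) ltac:(lra).
  move: Ka Jr Hb; rewrite !ltr_norml => /andP[? ?] /andP[? ?] /andP[? ?].
  by apply/andP; split; lra.
have Kb := K r0' b ltac:(lra) br.
move: Ka Kb; rewrite !ltr_norml => /andP[? ?] /andP[? ?]; apply/andP; split; lra.
Unshelve. all: by end_near. Qed.

Lemma near_all_seq (I : eqType) (U : Type) (G : set_system U) (FG : Filter G)
    (s : seq I) (P : I -> U -> Prop) :
  (forall i, i \in s -> \forall u \near G, P i u) ->
  \forall u \near G, forall i, i \in s -> P i u.
Proof.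
elim: s => [_|a s IHs Ps]; first exact: nearW.
have := IHs (fun i si => Ps i (mem_behead (s := a :: s) si)).
have := Ps a (mem_head a s).
apply: filterS2 => u Pa Pu i; rewrite inE => /orP[/eqP ->//|]; exact: Pu.
Qed.

Lemma near_subseq (mk : nat -> nat) (P : nat -> Prop) :
  (forall k, (k <= mk k)%N) ->
  (\forall m \near \oo, P m) -> \forall k \near \oo, P (mk k).
Proof.
move=> kmk [N _ PN]; exists N => //= k /= Nk.
by apply: PN => /=; exact: leq_trans Nk (kmk k).
Qed.

(** Once the mesh is below all distances between points of [F], these lie in distinct dyadic
    intervals, and the sum splits into the intervals that are hit and the others. The quantifier
    over [g] is inside the limit because [g] will depend on [m]. *)
Lemma dyadic_hits (R : realType) (t : R) (F : seq R) :
  finsub `]0, t]%classic F ->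
  exists ix : nat -> R -> nat,
    (forall m s, s \in F ->
      (ix m s < 2 ^ m)%N /\ dyadic t m (ix m s) < s <= dyadic t m (ix m s).+1) /\
    \forall m \near \oo, forall g : nat -> R,
      \sum_(0 <= i < 2 ^ m) g i = \sum_(s <- F) g (ix m s) +
        \sum_(0 <= i < 2 ^ m | i \notin map (ix m) F) g i.
Proof.
move=> [uF FD].
have /choice[ix' ixP] : forall ms : nat * R, exists i, ms.2 \in F ->
    (i < 2 ^ ms.1)%N /\ dyadic t ms.1 i < ms.2 <= dyadic t ms.1 i.+1.
  move=> [m s] /=; have [sF|_] := boolP (s \in F); last by exists 0%N.
  have := FD _ sF; rewrite /= in_itv/= => /(dyadic_index m)[i im ii].
  by exists i.
pose ix m s := ix' (m, s).
have {}ixP m s : s \in F ->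
    (ix m s < 2 ^ m)%N /\ dyadic t m (ix m s) < s <= dyadic t m (ix m s).+1.
  exact: (ixP (m, s)).
exists ix; split => //.
have sep : \forall m \near \oo, forall s, s \in F -> forall s', s' \in F ->
    s != s' -> t / 2 ^+ m < `|s - s'|.
  apply: near_all_seq => s sF; apply: near_all_seq => s' s'F.
  have [->|ss'] := eqVneq s s'; first exact: nearW.
  have /(dyadic_mesh t) : 0 < `|s - s'| by rewrite normr_gt0 subr_eq0.
  exact: filterS.
move: sep; apply: filterS => m sep g.
have inj : {in F &, injective (ix m)}.
  move=> s s' sF s'F E; apply/eqP/negPn/negP => ss'.
  have := sep _ sF _ s'F ss'.
  have [_] := ixP m s sF; have [_] := ixP m s' s'F; rewrite E dyadicS.
  move=> /andP[a1 a2] /andP[b1 b2].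
  by apply/negP; rewrite -leNgt ler_distl; apply/andP; split; lra.
have uix : uniq (map (ix m) F) by rewrite map_inj_in_uniq.
rewrite (bigID (mem (map (ix m) F)))/=; congr (_ + _).
rewrite -big_filter -[RHS](big_map (ix m) xpredT).
apply: perm_big; apply: uniq_perm => //; first by rewrite filter_uniq// iota_uniq.
move=> i; rewrite mem_filter mem_index_iota /=.
apply/andP/idP => [[]//|ii]; split => //.
by move: ii => /mapP[s sF ->]; case: (ixP m s sF).
Qed.


Lemma near_dyadic_sum_jump (R : realType) (T t : R) (f x : R -> R) (F : seq R)
    (ix : nat -> R -> nat) (e : R) :
  cadlag T x -> t <= T -> continuous f -> finsub `]0, t]%classic F ->
  (forall m s, s \in F ->
    (ix m s < 2 ^ m)%N /\ dyadic t m (ix m s) < s <= dyadic t m (ix m s).+1) ->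
  0 < e ->
  \forall m \near \oo,
    `|\sum_(s <- F) f (dyadic_incr x t m (ix m s)) -
      \sum_(s <- F) f (jump x s)| <= e.
Proof.
move=> cx tT cf [_ FD] ixP e0.
(* The tolerance is shared among the points of [F]; the successor keeps the denominator positive
   when [F] is empty. *)
pose c : R := e / (size F).+1%:R.
have c0 : 0 < c by rewrite divr_gt0.
have : \forall m \near \oo, forall s, s \in F ->
    `|f (dyadic_incr x t m (ix m s)) - f (jump x s)| <= c.
  apply: near_all_seq => s sF.
  have s0t : 0 < s <= t by have := FD _ sF; rewrite /= in_itv.
  have := @dyadic_incr_jump _ T t s x (ix^~ s) cx tT s0t
    (fun m => (ixP m s sF).1) (fun m => (ixP m s sF).2).
  move=> /(cvg_comp _ _)/(_ (cf (jump x s)))/cvgrPdist_le/(_ c c0).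
  by apply: filterS => m /=; rewrite distrC.
apply: filterS => m H; rewrite -sumrB.
apply: (le_trans (ler_norm_sum _ _ _)).
rewrite big_seq; apply: (@le_trans _ _ (\sum_(s <- F | s \in F) c)).
  by apply: ler_sum => s; exact: H.
rewrite -big_seq big_const_seq count_predT iter_addr_0 -mulr_natr /c mulrAC.
by rewrite ler_pdivrMr// ler_wpM2l ?ler_nat// ltW.
Qed.

(** In the limit the intervals that meet [F] contribute the squared jumps and all others something
    nonnegative, so partial sums of squared jumps inherit the bound [V]. *)
Lemma jump_sq_bound (R : realType) (T t V : R) (x : R -> R) (mk : nat -> nat) :
  cadlag T x -> t <= T -> (forall k, (k <= mk k)%N) ->
  (forall k, dyadic_sum (fun y => y ^+ 2) x t (mk k) <= V) ->
  forall F, finsub `]0, t]%classic F -> \sum_(s <- F) jump x s ^+ 2 <= V.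
Proof.
move=> cx tT kmk SV F FD.
have [ix [ixP hits]] := dyadic_hits FD.
apply/ler_addgt0Pr => e e0.
have csq : continuous (fun y : R => y ^+ 2) by exact: exprn_continuous.
have := near_dyadic_sum_jump cx tT csq FD ixP e0.
move=> /(filterI hits)/(near_subseq kmk)[N _ /(_ N (leqnn N))] /= [S].
have := SV N; rewrite /dyadic_sum S => SVN.
rewrite ler_distlC => /andP[_ le1]; apply: (le_trans le1).
rewrite lerD2r; apply: le_trans SVN; rewrite lerDl.
by apply: sumr_ge0 => i _; exact: sqr_ge0.
Qed.

(** [F0] exhausts the squared jumps up to a small remainder, so every jump outside [F] is below
    [dlt / 2], and eventually every increment missing [F] is below [dlt]. There [f] is at most [eta]
    times the square, for a total of at most [eta * V]. The conclusion speaks of finite sets so that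
    [F] can still be enlarged when the jump sums are approximated. *)
Lemma dyadic_sum_net (R : realType) (T t V : R) (f x : R -> R)
    (mk : nat -> nat) :
  cadlag T x -> 0 <= t <= T -> (forall k, (k <= mk k)%N) ->
  (forall k, dyadic_sum (fun y => y ^+ 2) x t (mk k) <= V) ->
  continuous f ->
  (forall e : R, 0 < e -> exists2 dlt : R, 0 < dlt &
     forall y, `|y| < dlt -> `|f y| <= e * y ^+ 2) ->
  forall e : R, 0 < e -> exists2 F0, finsub `]0, t]%classic F0 &
    forall F, finsub `]0, t]%classic F -> {subset F0 <= F} ->
      \forall k \near \oo,
        `|dyadic_sum f x t (mk k) - \sum_(s <- F) f (jump x s)| <= e.
Proof.
move=> cx /andP[t0 tT] kmk SV cf fo e e0.
have V0 : 0 <= V.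
  by apply: le_trans (SV 0%N); apply: sumr_ge0 => i _; exact: sqr_ge0.
(* This gives [eta * V <= e / 2]; the [+ 1] keeps the denominator positive when [V = 0]. *)
pose eta : R := e / (2 * (V + 1)).
have eta0 : 0 < eta by rewrite divr_gt0// mulr_gt0// ltr_wpDl.
have [dlt d0 fd] := fo _ eta0.
have JV := jump_sq_bound cx tT kmk SV.
have c0 : 0 < dlt ^+ 2 / 16 by rewrite divr_gt0// exprn_gt0.
have [F0 DF0 F0P] := finsub_esum_approx (fun s => sqr_ge0 (jump x s)) JV c0.
exists F0 => // F DF sF.
(* The sums of squares over [F] and [s :: F] are both within [dlt ^+ 2 / 16] of the total, so the
   squared jump at [s] is at most [dlt ^+ 2 / 8], which is below [(dlt / 2) ^+ 2]. *)
have small s : 0 < s <= t -> s \notin F -> `|jump x s| < dlt / 2.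
  move=> s0t sNF.
  have DsF : finsub `]0, t]%classic (s :: F).
    split; first by rewrite /= sNF DF.1.
    move=> i; rewrite inE => /orP[/eqP ->|]; last exact: DF.2.
    by rewrite /= in_itv.
  have := F0P _ DsF (fun i i0 => mem_behead (s := s :: F) (sF i i0)).
  have := F0P _ DF sF; rewrite big_cons; set Q := fine _.
  rewrite !ler_norml => /andP[? ?] /andP[? ?].
  have : jump x s ^+ 2 < (dlt / 2) ^+ 2.
    by apply: (@le_lt_trans _ _ (dlt ^+ 2 / 8)); [lra|rewrite expr_div_n; nra].
  by rewrite -[X in X < _]real_normK ?num_real// ltr_pXn2r// nnegrE; lra.
have [ix [ixP hits]] := dyadic_hits DF.
have e20 : 0 < e / 2 by rewrite divr_gt0.
have := near_dyadic_sum_jump cx tT cf DF ixP e20.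
have t0T : 0 <= t <= T by rewrite t0.
have d20 : 0 < dlt / 2 by rewrite divr_gt0.
move=> /(filterI hits)/(filterI (cadlag_small_incr cx t0T d20 small)).
move=> /(near_subseq kmk); apply: filterS => k [smallk [S hit]].
have hitsmall i : (i < 2 ^ mk k)%N -> i \notin map (ix (mk k)) F ->
    `|f (dyadic_incr x t (mk k) i)| <= eta * dyadic_incr x t (mk k) i ^+ 2.
  move=> ik iN; apply: fd.
  have -> : dlt = 2 * (dlt / 2) by rewrite mulrC divfK.
  (* Dyadic intervals of one level are disjoint, so a point of [F] in interval [i] would make [i]
     the index of that point. *)
  apply: smallk => // s sFs; apply/negP => /andP[s1 s2].
  have [ixlt /andP[s3 s4]] := ixP (mk k) s sFs.
  move/negP: iN; apply; apply/mapP; exists s => //.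
  apply/eqP; rewrite eqn_leq; apply/andP; split; rewrite leqNgt; apply/negP => lt.
    by have := dyadic_le (mk k) t0 lt; lra.
  by have := dyadic_le (mk k) t0 lt; lra.
rewrite /dyadic_sum S addrAC (le_trans (ler_normD _ _))// [leRHS](splitr e).
apply: lerD => //; apply: (le_trans (ler_norm_sum _ _ _)).
rewrite big_nat_cond.
apply: (@le_trans _ _ (\sum_(0 <= i < 2 ^ mk k) eta * dyadic_incr x t (mk k) i ^+ 2)).
  rewrite [leRHS](bigID (fun i => i \notin [seq ix (mk k) i | i <- F]))/=.
  rewrite ler_wpDr//.
    by apply: sumr_ge0 => i _; rewrite mulr_ge0 ?sqr_ge0// ltW.
  rewrite [leRHS]big_nat_cond; apply: ler_sum => i /andP[ik iN].
  exact: hitsmall.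
rewrite -mulr_sumr; apply: (@le_trans _ _ (eta * V)).
  by apply: ler_wpM2l; [exact: ltW|exact: (SV k)].
have V10 : 0 < 2 * (V + 1) by lra.
by rewrite /eta mulrAC ler_pdivrMr//; lra.
Qed.

(** * Elementary bounds for sine and cosine *)

Lemma one_subr_cos (R : realType) (a : R) : 1 - cos a = 2 * sin (a / 2) ^+ 2.
Proof.
have -> : cos a = cos ((a / 2) *+ 2) by rewrite -mulr_natr divfK.
by rewrite cos_mulr2n cos2sin2; ring.
Qed.

Lemma sin_MVT (R : realType) (b : R) : 0 <= b ->
  exists2 c, 0 <= c <= b & sin b = cos c * b.
Proof.
move=> b0.
have [|c cI] := @MVT_segment R sin cos 0 b b0 (fun x _ => is_derive_sin x).
  by apply: continuous_subspaceT => x; exact: continuous_sin.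
by rewrite sin0 !subr0 => ->; exists c.
Qed.

Lemma ler_norm_sin (R : realType) (b : R) : `|sin b| <= `|b|.
Proof.
wlog b0 : b / 0 <= b.
  move=> H; have [/H//|b0] := leP 0 b.
  by rewrite -normrN -sinN -[leRHS]normrN; apply: H; lra.
have [c _ ->] := sin_MVT b0.
by rewrite normrM -[leRHS]mul1r ler_wpM2r// cos_max.
Qed.

Lemma one_subr_cos_ge0 (R : realType) (a : R) : 0 <= 1 - cos a.
Proof. by rewrite subr_ge0 cos_le1. Qed.

Lemma one_subr_cos_le2 (R : realType) (a : R) : 1 - cos a <= 2.
Proof. by have := cos_geN1 a; lra. Qed.

Lemma one_subr_cos_le (R : realType) (a : R) : 1 - cos a <= a ^+ 2 / 2.
Proof.
rewrite one_subr_cos.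
have : sin (a / 2) ^+ 2 <= (a / 2) ^+ 2.
  rewrite -[leLHS]real_normK ?num_real// -[leRHS]real_normK ?num_real//.
  by rewrite ler_pXn2r// ?nnegrE// ler_norm_sin.
by rewrite expr_div_n; lra.
Qed.

(** For [0 <= b] the mean value theorem gives [b - sin b = (1 - cos c) * b] with [0 <= c <= b], and
    [1 - cos c] is at most [c ^+ 2 / 2]. *)
Lemma norm_sub_sin_le (R : realType) (b : R) : `|b - sin b| <= `|b| ^+ 3 / 2.
Proof.
wlog b0 : b / 0 <= b.
  move=> H; have [/H//|b0] := leP 0 b.
  have := H (- b) ltac:(lra).
  by rewrite sinN -opprD !normrN.
have [c /andP[c0 cb] ->] := sin_MVT b0.
rewrite -{1}[b]mul1r -mulrBl normrM (ger0_norm (one_subr_cos_ge0 c)).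
rewrite (ger0_norm b0).
apply: (@le_trans _ _ (c ^+ 2 / 2 * b)).
  by rewrite ler_wpM2r// one_subr_cos_le.
rewrite [leRHS](_ : _ = b ^+ 2 / 2 * b); last by rewrite exprSr; ring.
by rewrite ler_wpM2r// ler_wpM2r// ler_pXn2r// nnegrE.
Qed.

(** With [b = a / 2] the left side is [2 * (b - sin b) * (b + sin b)] up to sign: a factor of third
    order times one of first order. *)
Lemma cos_taylor2 (R : realType) (a : R) :
  `|1 - cos a - a ^+ 2 / 2| <= a ^+ 4 / 8.
Proof.
rewrite one_subr_cos; set b := a / 2.
have -> : a ^+ 2 / 2 = 2 * b ^+ 2 by rewrite /b expr_div_n; field.
have -> : a ^+ 4 / 8 = 2 * `|b| ^+ 4.
  by rewrite (exprM `|b| 2 2 : `|b| ^+ 4 = _) real_normK ?num_real// /b; field.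
clearbody b.
have -> : 2 * sin b ^+ 2 - 2 * b ^+ 2 = - (2 * ((b - sin b) * (b + sin b))) by ring.
rewrite normrN !normrM (ger0_norm (ler0n _ 2)) ler_wpM2l//.
apply: (@le_trans _ _ ((`|b| ^+ 3 / 2) * (2 * `|b|))); last first.
  by rewrite le_eqVlt; apply/orP; left; apply/eqP; field.
apply: ler_pM => //; first exact: norm_sub_sin_le.
rewrite (le_trans (ler_normD _ _))//.
by have := ler_norm_sin b; lra.
Qed.

(** * Limits of dyadic sums of powers and of cosines *)

Lemma dyadic_sum_pow_cvg (R : realType) (T t V : R) (x : R -> R)
    (mk : nat -> nat) (n : nat) :
  cadlag T x -> 0 <= t <= T -> (forall k, (k <= mk k)%N) ->
  (forall k, dyadic_sum (fun y => y ^+ 2) x t (mk k) <= V) -> (3 <= n)%N ->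
  dyadic_sum (fun y => y ^+ n) x t (mk k) @[k --> \oo] -->
    rsum `]0, t]%classic (fun s => jump x s ^+ n).
Proof.
move=> cx t0T kmk SV n3; have /andP[t0 tT] := t0T.
have JV := jump_sq_bound cx tT kmk SV.
have V0 : 0 <= V.
  by apply: le_trans (SV 0%N); apply: sumr_ge0 => i _; exact: sqr_ge0.
(* Since [3 <= n], the factor with exponent [n - 2] vanishes at [0], so the power is negligible
   against [y ^+ 2]. *)
have nE (y : R) : `|y ^+ n| = `|y| ^+ (n - 2) * y ^+ 2.
  by rewrite normrX -(real_normK (num_real y)) -exprD subnK// ltnW.
(* Each squared jump is at most [V], hence each jump is at most [1 + V] in absolute value; this
   bounds the extra factor and makes the jump sum absolutely convergent. *)
have JK F : finsub `]0, t]%classic F ->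
    \sum_(s <- F) `|jump x s ^+ n| <= (1 + V) ^+ (n - 2) * V.
  move=> DF; apply: le_trans (ler_wpM2l _ (JV F DF)); last first.
    by rewrite exprn_ge0// addr_ge0.
  rewrite mulr_sumr big_seq [leRHS]big_seq; apply: ler_sum => s sF.
  rewrite nE ler_wpM2r ?sqr_ge0// lerXn2r ?nnegrE//; first lra.
  have := JV [:: s]; rewrite big_seq1 => /(_ _)Js.
  have {}Js : jump x s ^+ 2 <= V.
    by apply: Js; split => // i; rewrite inE => /eqP ->; exact: DF.2.
  rewrite -(@ler_pXn2r _ 2) ?nnegrE//; last lra.
  by rewrite real_normK ?num_real//; nra.
apply/cvgrPdist_le => e e0.
have e20 : 0 < e / 2 by rewrite divr_gt0.
have [F1 DF1 H1] := rsum_approx JK e20.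
have [||F2 DF2 H2] := @dyadic_sum_net R T t V (fun y => y ^+ n) x mk cx t0T kmk SV _ _ (e / 2) e20.
- exact: exprn_continuous.
- move=> c c0; exists (Num.min 1 c); first by rewrite lt_min ltr01.
  move=> y; rewrite lt_min => /andP[y1 yc]; rewrite nE ler_wpM2r ?sqr_ge0//.
  apply: le_trans (ltW yc); rewrite -[leRHS]expr1.
  by apply: ler_wiXn2l => //; [exact: ltW|lia].
pose F := undup (F1 ++ F2).
have DF := finsub_undup_cat DF1 DF2.
have {}H1 := H1 F DF ltac:(by move=> i iF; rewrite mem_undup mem_cat iF).
have := H2 F DF ltac:(by move=> i iF; rewrite mem_undup mem_cat iF orbT).
apply: filterS => k; move: H1; rewrite !ler_norml => /andP[? ?] /andP[? ?].
by apply/andP; split; lra.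
Qed.

(** For fixed [u], the function [f] is of fourth order at [0], so its dyadic sums approach its sum
    over the jumps. As [u] grows, the cosine part of that jump sum becomes negligible and only minus
    the squared jumps remains. [F1] is chosen before [u], whereas [F2] depends on [u]. *)
Lemma dyadic_sum_cos_net (R : realType) (T t V : R) (x : R -> R)
    (mk : nat -> nat) :
  cadlag T x -> 0 <= t <= T -> (forall k, (k <= mk k)%N) ->
  (forall k, dyadic_sum (fun y => y ^+ 2) x t (mk k) <= V) ->
  forall e : R, 0 < e -> \forall u \near \oo, \forall k \near \oo,
    `|2 / u%:R ^+ 2 * dyadic_sum (fun y => 1 - cos (u%:R * y)) x t (mk k) -
      (dyadic_sum (fun y => y ^+ 2) x t (mk k) -
       rsum `]0, t]%classic (fun s => jump x s ^+ 2))| <= e.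
Proof.
move=> cx t0T kmk SV e e0; have /andP[t0 tT] := t0T.
have JV := jump_sq_bound cx tT kmk SV.
have JK F : finsub `]0, t]%classic F -> \sum_(s <- F) `|jump x s ^+ 2| <= V.
  by move=> /JV; under [X in _ -> X <= _]eq_bigr do rewrite ger0_norm ?sqr_ge0//.
(* One [c] comes from the dyadic sum of [f], three from the cosine part over the jumps, and one from
   the sum of squared jumps. *)
pose c := e / 5.
have c0 : 0 < c by rewrite divr_gt0.
have [F1 DF1 H1] := rsum_approx JK c0.
near=> u.
have u0 : 0 < u%:R :> R by rewrite ltr0n; near: u; exact: nbhs_infty_gt.
have u20 : 0 < (u%:R : R) ^+ 2 by rewrite exprn_gt0.
have uF : 4 * (size F1)%:R <= c * u%:R :> R.
  rewrite [leRHS]mulrC -ler_pdivrMr//; near: u; exact: nbhs_infty_ger.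
pose f (y : R) := 2 / u%:R ^+ 2 * (1 - cos (u%:R * y)) - y ^+ 2.
have fb y : `|f y| <= (u%:R ^+ 2 / 4) * y ^+ 2 * y ^+ 2.
  have -> : f y = 2 / u%:R ^+ 2 * (1 - cos (u%:R * y) - (u%:R * y) ^+ 2 / 2).
    by rewrite /f; field; rewrite gt_eqF.
  rewrite normrM ger0_norm; last by rewrite divr_ge0// ltW.
  apply: (le_trans (ler_wpM2l _ (cos_taylor2 _))); first by rewrite divr_ge0// ltW.
  by rewrite le_eqVlt; apply/orP; left; apply/eqP; field; rewrite gt_eqF.
have [||F2 DF2 H2] := @dyadic_sum_net R T t V f x mk cx t0T kmk SV _ _ c c0.
- move=> y; apply: cvgB; last exact: exprn_continuous.
  apply: cvgM; first exact: cvg_cst.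
  apply: cvgB; first exact: cvg_cst.
  apply: (@cvg_comp _ _ _ (fun y => u%:R * y) cos _ (nbhs (u%:R * y))); last exact: continuous_cos.
  by apply: cvgM; [exact: cvg_cst|exact: cvg_id].
- move=> h h0; exists (Num.min 1 (h * 4 / u%:R ^+ 2)).
    by rewrite lt_min ltr01/= divr_gt0// mulr_gt0.
  move=> y; rewrite lt_min => /andP[y1 yh]; apply: (le_trans (fb y)).
  rewrite ler_wpM2r ?sqr_ge0// mulrAC ler_pdivrMr// mulrC -ler_pdivlMr//.
  apply: le_trans (ltW yh); rewrite -(real_normK (num_real y)) expr2.
  by rewrite ler_piMr// ltW.
pose F := undup (F1 ++ F2).
have DF := finsub_undup_cat DF1 DF2.
have sF1 : {subset F1 <= F} by move=> i iF; rewrite mem_undup mem_cat iF.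
have H1F := H1 F DF sF1.
have H1F1 := H1 F1 DF1 (fun _ h => h).
have H2F := H2 F DF ltac:(by move=> i iF; rewrite mem_undup mem_cat iF orbT).
(* The points of [F1] contribute at most [4 / u] each, [c] in all by [uF]. The others are bounded by
   their squared jumps, which sum to at most [2 * c] because [F] and [F1] both approximate the total
   within [c]. *)
have cosF : 0 <= \sum_(s <- F) (2 / u%:R ^+ 2 * (1 - cos (u%:R * jump x s))) <= 2 * c + c.
  apply/andP; split.
    by apply: sumr_ge0 => s _; rewrite mulr_ge0 ?one_subr_cos_ge0// divr_ge0// ltW.
  have perF : perm_eq F1 [seq s <- F | s \in F1].
    apply: uniq_perm; [exact: DF1.1|by rewrite filter_uniq// DF.1|].
    by move=> i; rewrite mem_filter; case: (boolP (i \in F1)) => //= /sF1 ->.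
  have FE (g : R -> R) : \sum_(s <- F) g s = \sum_(s <- F1) g s + \sum_(s <- F | s \notin F1) g s.
    by rewrite (bigID (mem F1))/= -big_filter -(perm_big _ perF).
  have F2s : \sum_(s <- F | s \notin F1) jump x s ^+ 2 <= 2 * c.
    have := FE (fun s => jump x s ^+ 2).
    by move: H1F H1F1; rewrite !ler_norml => /andP[? ?] /andP[? ?] E; lra.
  rewrite FE [leRHS]addrC; apply: lerD.
    apply: (@le_trans _ _ (\sum_(s <- F1) 4 / u%:R)).
      apply: ler_sum => s _.
      apply: (@le_trans _ _ (2 / u%:R ^+ 2 * 2)).
        by apply: ler_wpM2l; [rewrite divr_ge0// ltW|exact: one_subr_cos_le2].
      have u1 : 1 <= u%:R :> R by rewrite ler1n -(ltr0n R).
      rewrite mulrAC -natrM ler_wpM2l// lef_pV2 ?posrE// expr2.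
      by rewrite ler_pMl.
    rewrite big_const_seq count_predT iter_addr_0.
    by rewrite -[leLHS]mulr_natr [leLHS]mulrAC ler_pdivrMr.
  apply: le_trans F2s; apply: ler_sum => s _.
  rewrite [leLHS]mulrAC ler_pdivrMr//.
  by have := one_subr_cos_le (u%:R * jump x s); rewrite exprMn; lra.
move: H2F; apply: filterS => k.
have -> : dyadic_sum f x t (mk k) =
    2 / u%:R ^+ 2 * dyadic_sum (fun y => 1 - cos (u%:R * y)) x t (mk k) -
    dyadic_sum (fun y => y ^+ 2) x t (mk k).
  by rewrite /dyadic_sum mulr_sumr -sumrB.
have -> : \sum_(s <- F) f (jump x s) =
    \sum_(s <- F) (2 / u%:R ^+ 2 * (1 - cos (u%:R * jump x s))) -
    \sum_(s <- F) jump x s ^+ 2 by rewrite -sumrB.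
move: H1F cosF; rewrite !ler_norml => /andP[? ?] /andP[? ?] /andP[? ?].
have ce : e = 5 * c by rewrite /c mulrC divfK.
by rewrite ce; apply/andP; split; lra.
Unshelve. all: by end_near. Qed.

(** * The Gaussian part of a Levy process *)

(** The joint law of [(U, V)] agrees with the product of the laws on rectangles, hence everywhere,
    and Tonelli's theorem factors the integral. *)
Lemma ge0_integral_indep (d : measure_display) (Omega : measurableType d)
    (R : realType) (P : probability Omega R) (U V : Omega -> R) :
  measurable_fun setT U -> measurable_fun setT V ->
  (forall w, 0 <= U w) -> (forall w, 0 <= V w) ->
  (forall A B : set R, measurable A -> measurable B ->
    P (U @^-1` A `&` V @^-1` B) = (P (U @^-1` A) * P (V @^-1` B))%E) ->
  (\int[P]_w (U w * V w)%:E = (\int[P]_w (U w)%:E) * (\int[P]_w (V w)%:E))%E.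
Proof.
move=> mU mV U0 V0 indep.
pose UR : {mfun Omega >-> R} := HB.pack U (isMeasurableFun.Build _ _ _ _ U mU).
pose VR : {mfun Omega >-> R} := HB.pack V (isMeasurableFun.Build _ _ _ _ V mV).
have mUV := measurable_fun_pair mU mV.
pose UVR : {mfun Omega >-> (R * R)%type} :=
  HB.pack (fun w => (U w, V w)) (isMeasurableFun.Build _ _ _ _ _ mUV).
have prodE := product_measure_unique (m1 := distribution P UR)
  (m2 := distribution P VR) (m' := distribution P UVR) indep.
(* The absolute values make the integrand nonnegative on the whole plane and change nothing on the
   range of [(U, V)]. *)
pose f (z : R * R) : \bar R := (`|z.1| * `|z.2|)%:E.
pose aE (y : R) : \bar R := (`|y|)%:E.
have mabs : measurable_fun setT aE.
  by apply/measurable_EFinP; exact: normr_measurable.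
have mf : measurable_fun setT f.
  apply/measurable_EFinP; apply: measurable_funM => /=.
    by apply: (@measurableT_comp _ _ _ _ _ _ (@Num.norm R R));
      [exact: normr_measurable|exact: measurable_fst].
  by apply: (@measurableT_comp _ _ _ _ _ _ (@Num.norm R R));
    [exact: normr_measurable|exact: measurable_snd].
transitivity (\int[distribution P UVR]_z f z)%E.
  rewrite ge0_integral_pushforward//.
    by rewrite preimage_setT; apply: eq_integral => w _; rewrite /f /= !ger0_norm.
  by move=> z _; rewrite lee_fin mulr_ge0.
rewrite (eq_measure_integral (distribution P UR \x distribution P VR)%E); last first.
  by move=> A mA _; rewrite -prodE.
rewrite fubini_tonelli1//; last by move=> z; rewrite lee_fin mulr_ge0.
have intE (W : Omega -> R) (mW : measurable_fun setT W) : (forall w, 0 <= W w) ->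
    (\int[pushforward P W]_y aE y = \int[P]_w (W w)%:E)%E.
  move=> W0; rewrite ge0_integral_pushforward//.
    by rewrite preimage_setT; apply: eq_integral => w _; rewrite /aE /= ger0_norm.
  by move=> z _; rewrite lee_fin.
have aE0 y : (0 <= aE y)%E by rewrite lee_fin.
have innerE x : (\int[distribution P VR]_y (f (x, y)) =
    aE x * \int[P]_w (V w)%:E)%E.
  transitivity (\int[distribution P VR]_y (aE x * aE y))%E.
    by apply: eq_integral => y _.
  rewrite ge0_integralZl//.
  by rewrite (intE V).
rewrite /fubini_F; under eq_integral do rewrite innerE.
rewrite ge0_integralZr//; last first.
  by apply: integral_ge0 => w _; rewrite lee_fin.
by rewrite (intE U).
Qed.

(** In the expanded second moment the off-diagonal terms equal [c * c], which the centring cancels,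
    and each diagonal term is at most [2 * c] because [Y i] takes values in [[0, 2]]. *)
Lemma variance_sum_bound (d : measure_display) (Omega : measurableType d)
    (R : realType) (P : probability Omega R) (Y : nat -> Omega -> R) (c : R)
    (N : nat) :
  (forall i, (i < N)%N -> measurable_fun setT (Y i)) ->
  (forall i w, 0 <= Y i w <= 2) ->
  (forall i, (i < N)%N -> (\int[P]_w (Y i w)%:E = c%:E)%E) ->
  (forall i j, (i < j)%N -> (j < N)%N ->
     (\int[P]_w (Y i w * Y j w)%:E = (c * c)%:E)%E) ->
  (\int[P]_w ((\sum_(0 <= i < N) Y i w - N%:R * c) ^+ 2)%:E <=
    (2 * (N%:R * c))%:E)%E.
Proof.
move=> mY' Y02 EY EYY.
(* Replacing [Y i] by [0] for [N <= i] makes measurability unconditional. *)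
pose Z i w := if (i < N)%N then Y i w else 0.
have mZ i : measurable_fun setT (Z i).
  rewrite /Z; have [iN|_] := boolP (i < N)%N; last exact: measurable_cst.
  by apply: eq_measurable_fun (mY' i iN) => w _.
have Z0 i w : 0 <= Z i w by rewrite /Z; case: ifP => // _; case/andP: (Y02 i w).
have ZY i w : (i < N)%N -> Z i w = Y i w by rewrite /Z => ->.
pose S w := \sum_(0 <= i < N) Z i w.
have SE w : \sum_(0 <= i < N) Y i w = S w.
  by rewrite /S; apply: eq_big_nat => i /andP[_ iN]; rewrite ZY.
have mS : measurable_fun setT S by apply: measurable_sum => i; exact: mZ.
have S0 w : 0 <= S w by exact: sumr_ge0.
have [->|N0] := posnP N.
  under eq_integral do rewrite big_geq// mul0r subrr expr0n/=.
  by rewrite integral0 mul0r mulr0.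
have c0 : 0 <= c.
  rewrite -lee_fin -(EY 0%N N0); apply: integral_ge0 => w _.
  by rewrite lee_fin; case/andP: (Y02 0%N w).
set a := N%:R * c.
have a0 : 0 <= a by rewrite mulr_ge0.
have ES : (\int[P]_w (S w)%:E = a%:E)%E.
  under eq_integral do rewrite /S -sumEFin.
  rewrite ge0_integral_sum//; last 2 first.
    by move=> i; apply/measurable_EFinP.
    by move=> i w _; rewrite lee_fin.
  rewrite (eq_big_nat _ _ (F2 := fun=> c%:E)).
    by rewrite sumEFin sumr_const_nat subn0 -mulr_natl.
  move=> i /andP[_ iN]; rewrite -(EY i iN); apply: eq_integral => w _.
  by rewrite ZY.
have ESS : (\int[P]_w (S w ^+ 2)%:E <= (2 * a + a ^+ 2)%:E)%E.
  have mZZ i j : measurable_fun setT (fun w => (Z i w * Z j w)%:E).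
    by apply/measurable_EFinP; exact: measurable_funM.
  have -> : (\int[P]_w (S w ^+ 2)%:E =
      \sum_(0 <= i < N) \sum_(0 <= j < N) \int[P]_w (Z i w * Z j w)%:E)%E.
    transitivity (\int[P]_w (\sum_(0 <= i < N) (\sum_(0 <= j < N) Z i w * Z j w)%:E))%E.
      apply: eq_integral => w _; rewrite sumEFin expr2 {1}/S mulr_suml.
      by congr EFin; apply: eq_bigr => i _; rewrite /S mulr_sumr.
    rewrite ge0_integral_sum//; last 2 first.
      by move=> i; apply/measurable_EFinP; apply: measurable_sum => j; apply: measurable_funM.
      by move=> i w _; rewrite lee_fin; apply: sumr_ge0 => j _; rewrite mulr_ge0.
    apply: eq_bigr => i _; under eq_integral do rewrite -sumEFin.
    by rewrite ge0_integral_sum// => j w _; rewrite lee_fin mulr_ge0.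
  apply: (@le_trans _ _ (\sum_(0 <= i < N) \sum_(0 <= j < N)
      ((i == j)%:R * (2 * c) + c * c)%:E)%E).
    rewrite big_nat_cond [leRHS]big_nat_cond; apply: lee_sum => i /andP[/andP[_ iN] _].
    rewrite big_nat_cond [leRHS]big_nat_cond; apply: lee_sum => j /andP[/andP[_ jN] _].
    case: (ltngtP i j) => ij.
    - rewrite mul0r add0r -(EYY i j ij jN) le_eqVlt; apply/orP; left; apply/eqP.
      by apply: eq_integral => w _; rewrite !ZY.
    - rewrite mul0r add0r -(EYY j i ij iN) le_eqVlt; apply/orP; left; apply/eqP.
      by apply: eq_integral => w _; rewrite !ZY// mulrC.
    - rewrite -ij mul1r; apply: (@le_trans _ _ (2 * c)%:E); last first.
        by rewrite lee_fin lerDl mulr_ge0.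
      rewrite EFinM -(EY i iN) -ge0_integralZl//; last 2 first.
        by apply/measurable_EFinP; exact: mY'.
        by move=> w _; rewrite lee_fin; case/andP: (Y02 i w).
      apply: ge0_le_integral => //.
      + by move=> w _; rewrite lee_fin mulr_ge0.
      + by apply: measurable_funeM; apply/measurable_EFinP; exact: mY'.
      + move=> w _; rewrite -EFinM lee_fin ZY//.
        by case/andP: (Y02 i w) => h1 h2; rewrite ler_wpM2r.
  under eq_bigr do rewrite sumEFin.
  rewrite sumEFin lee_fin.
  have rowE i : (i < N)%N ->
      \sum_(0 <= j < N) ((i == j)%:R * (2 * c) + c * c) = 2 * c + N%:R * (c * c).
    move=> iN; rewrite big_split/= sumr_const_nat subn0; congr (_ + _); last by rewrite mulr_natl.
    rewrite -mulr_suml (_ : \sum_(0 <= j < N) _ = 1) ?mul1r// big_mkord.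
    rewrite (bigD1 (Ordinal iN))//= eqxx big1 ?addr0// => j /eqP ji.
    by case: eqP => // ij; case: ji; apply: val_inj; rewrite /= ij.
  apply: (@le_trans _ _ (\sum_(0 <= i < N) (2 * c + N%:R * (c * c)))).
    rewrite big_nat_cond [leRHS]big_nat_cond; apply: ler_sum => i /andP[/andP[_ iN] _].
    by rewrite rowE.
  rewrite sumr_const_nat subn0 -[leLHS]mulr_natl /a le_eqVlt; apply/orP; left; apply/eqP.
  by ring.
(* [(S - a)^2 + 2 a S = S^2 + a^2], an identity between nonnegative functions *)
have E1 : (\int[P]_w ((S w - a) ^+ 2)%:E + (2 * a * a)%:E =
    \int[P]_w (S w ^+ 2)%:E + (a ^+ 2)%:E)%E.
  have mSa : measurable_fun setT (fun w => ((S w - a) ^+ 2)%:E).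
    by apply/measurable_EFinP; apply: measurable_funX; apply: measurable_funB.
  have mS2 : measurable_fun setT (fun w => ((S w) ^+ 2)%:E).
    by apply/measurable_EFinP; apply: measurable_funX.
  have mSE : measurable_fun setT (fun w => (S w)%:E) by exact/measurable_EFinP.
  rewrite EFinM -ES -ge0_integralZl//; last 2 first.
    by move=> w _; rewrite lee_fin.
    by rewrite lee_fin mulr_ge0.
  have -> : (a ^+ 2)%:E = (\int[P]_w (cst (a ^+ 2)%:E w))%E.
    rewrite integral_cst// -[LHS]mule1; congr (_ * _)%E.
    exact/esym/(probability_setT P).
  rewrite -!ge0_integralD//.
  - by apply: eq_integral => w _ /=; rewrite -EFinM -!EFinD; congr EFin; ring.
  - by move=> w _; rewrite lee_fin sqr_ge0.
  - by move=> w _; rewrite lee_fin sqr_ge0.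
  - by move=> w _; rewrite lee_fin sqr_ge0.
  - by move=> w _; rewrite -EFinM lee_fin !mulr_ge0.
  - exact: measurable_funeM.
under eq_integral do rewrite SE.
rewrite -(@leeD2rE _ (2 * a * a)%:E)// E1.
apply: le_trans (leeD2r _ ESS) _; rewrite -!EFinD lee_fin.
by rewrite le_eqVlt; apply/orP; left; apply/eqP; ring.
Qed.

(** Two possibly non-adjacent increments are the outer ones of three consecutive increments; the
    middle one is given the event [setT]. *)
Lemma levy_indep_pair (d : measure_display) (Omega : measurableType d)
    (R : realType) (P : probability Omega R) (T : R) (X : R -> Omega -> R)
    (a b c e : R) (A B : set R) :
  levy_process P T X -> 0 <= a -> a <= b -> b <= c -> c <= e -> e <= T ->
  measurable A -> measurable B ->
  P ((X b \- X a) @^-1` A `&` (X e \- X c) @^-1` B) =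
  (P ((X b \- X a)%R @^-1` A) * P ((X e \- X c)%R @^-1` B))%E.
Proof.
move=> lX a0 ab bc ce eT mA mB.
pose t (i : nat) := if i is 0%N then a else if i is 1%N then b else if i is 2%N then c else e.
have ti i : (i < 3)%N -> t i <= t i.+1 by case: i => [|[|[|]]].
pose C (i : 'I_3) : set (measurableTypeR R) :=
  if (i : nat) is 0%N then A else if (i : nat) is 1%N then setT else B.
have mC i : measurable (C i).
  by rewrite /C; case: i => -[|[|]] //= _; exact: measurableT.
have := levy_independent lX a0 ti eT mC.
rewrite !big_ord_recl big_ord0 /C /= mule1 preimage_setT.
rewrite (_ : P setT = 1%E) ?mul1e; last exact: (probability_setT P).
move=> <-; congr (P _); apply/seteqP; split => w /=.
  by move=> [wA wB] [[|[|[|]]] //= ?] _.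
move=> H; split.
  exact: (H (@Ordinal 3 0 isT) I).
exact: (H (@Ordinal 3 2 isT) I).
Qed.

(** * Mean and variance of the cosine sums *)

Lemma measurable_one_subr_cos (R : realType) (u : R) :
  measurable_fun setT (fun y : R => 1 - cos (u * y)).
Proof.
apply: continuous_measurable_fun => y.
apply: cvgB; first exact: cvg_cst.
apply: (@cvg_comp _ _ _ (fun y => u * y) cos _ (nbhs (u * y))); last exact: continuous_cos.
by apply: cvgM; [exact: cvg_cst|exact: cvg_id].
Qed.

Lemma integral_one_subr_cos (d : measure_display) (Omega : measurableType d)
    (R : realType) (P : probability Omega R) (Y : Omega -> R) (u v : R) :
  measurable_fun setT Y -> ('E_P[fun w => cos (u * Y w)] = v%:E)%E ->
  (\int[P]_w (1 - cos (u * Y w))%:E = (1 - v)%:E)%E.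
Proof.
move=> mY; rewrite expectation.unlock => Ecos.
have mcos : measurable_fun setT (fun w => cos (u * Y w)).
  apply: (@measurableT_comp _ _ _ _ _ _ cos _ (fun w => u * Y w)).
    by apply: continuous_measurable_fun; exact: continuous_cos.
  by apply: measurable_funM.
have i1 : P.-integrable setT (EFin \o cst (1 : R)).
  exact: finite_measure_integrable_cst.
have icos : P.-integrable setT (EFin \o (fun w => cos (u * Y w))).
  apply: le_integrable i1 => //; first exact/measurable_EFinP.
  by move=> w _; rewrite /= lee_fin normr1 cos_max.
under eq_integral do rewrite EFinB.
rewrite (integralB_EFin _ i1 icos)//.
rewrite (_ : (\int[P]_w _ = 1%:E)%E) ?Ecos -?EFinB//.
  by rewrite /= (integral_cst P measurableT 1%:E) mul1e; exact: (probability_setT P).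
Qed.

(* The real part of [1 - e^{h (A + i B)}]. *)
Definition cos_mean (R : realType) (A B h : R) : R :=
  1 - expR (h * A) * cos (h * B).

(** By stationarity the increment has the law of [X (t - s)], and the integral depends only on the
    law. *)
Lemma levy_incr_cos (d : measure_display) (Omega : measurableType d)
    (R : realType) (P : probability Omega R) (T : R) (X : R -> Omega -> R)
    (u A B : R) (s t : R) :
  levy_process P T X ->
  (forall t, 0 <= t <= T -> ('E_P[fun w => cos (u * X t w)] =
     (expR (t * A) * cos (t * B))%:E)%E) ->
  0 <= s -> s <= t -> t <= T ->
  (\int[P]_w (1 - cos (u * (X t w - X s w)))%:E = (cos_mean A B (t - s))%:E)%E.
Proof.
move=> lX EX s0 st tT.
have mX r : 0 <= r <= T -> measurable_fun setT (X r) by exact: levy_measurable lX _.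
have h0T : 0 <= t - s <= T by lra.
rewrite -(integral_one_subr_cos (mX _ h0T) (EX _ h0T)).
have mts : measurable_fun setT (X t \- X s).
  by apply: measurable_funB; apply: mX; lra.
have mh := mX _ h0T.
pose U : {mfun Omega >-> R} := HB.pack (X t \- X s) (isMeasurableFun.Build _ _ _ _ _ mts).
pose V : {mfun Omega >-> R} := HB.pack (X (t - s)) (isMeasurableFun.Build _ _ _ _ _ mh).
pose f (y : R) : \bar R := (1 - cos (u * y))%:E.
have mf : measurable_fun setT f by apply/measurable_EFinP; exact: measurable_one_subr_cos.
have f0 y : (0 <= f y)%E by rewrite lee_fin one_subr_cos_ge0.
transitivity (\int[distribution P U]_y f y)%E.
  by rewrite ge0_integral_pushforward// preimage_setT.
rewrite (eq_measure_integral (distribution P V)); last first.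
  by move=> C mC _; exact: (levy_stationary lX s0 st tT mC).
by rewrite ge0_integral_pushforward// preimage_setT.
Qed.

(** The increments over the [2 ^ m] intervals are independent and the summands share the mean
    [cos_mean A B (t / 2 ^+ m)], so [variance_sum_bound] applies. *)
Lemma dyadic_cos_variance (d : measure_display) (Omega : measurableType d)
    (R : realType) (P : probability Omega R) (T : R) (X : R -> Omega -> R)
    (u A B t : R) (m : nat) :
  levy_process P T X ->
  (forall t, 0 <= t <= T -> ('E_P[fun w => cos (u * X t w)] =
     (expR (t * A) * cos (t * B))%:E)%E) ->
  0 <= t <= T ->
  (\int[P]_w ((dyadic_sum (fun y => (1 - cos (u * y))%R) (X ^~ w) t m -
      (2 ^ m)%:R * cos_mean A B (t / 2 ^+ m)) ^+ 2)%:E <=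
    (2 * ((2 ^ m)%:R * cos_mean A B (t / 2 ^+ m)))%:E)%E.
Proof.
move=> lX EX /andP[t0 tT].
have mX r : 0 <= r <= T -> measurable_fun setT (X r) by exact: levy_measurable lX _.
pose Y i w := 1 - cos (u * dyadic_incr (X ^~ w) t m i).
have bnd i : (i <= 2 ^ m)%N -> 0 <= dyadic t m i <= T.
  by move=> im; rewrite dyadic_ge0//= (le_trans (dyadic_bound t0 im)).
have mI i : (i < 2 ^ m)%N ->
    measurable_fun setT (X (dyadic t m i.+1) \- X (dyadic t m i)).
  by move=> im; apply: measurable_funB; apply: mX; apply: bnd => //; exact: ltnW.
have mY i : (i < 2 ^ m)%N -> measurable_fun setT (Y i).
  move=> im; apply: (@measurableT_comp _ _ _ _ _ _ (fun y : R => 1 - cos (u * y)) _ _ _ (mI i im)).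
  exact: measurable_one_subr_cos.
have EY i : (i < 2 ^ m)%N -> (\int[P]_w (Y i w)%:E = (cos_mean A B (t / 2 ^+ m))%:E)%E.
  move=> im; rewrite (levy_incr_cos lX EX).
  - by rewrite dyadicS [_ + _ / _]addrC addrK.
  - exact: dyadic_ge0.
  - exact: dyadic_le.
  - by case/andP: (bnd i.+1 im).
apply: variance_sum_bound => //.
- by move=> i w; rewrite one_subr_cos_ge0 one_subr_cos_le2.
- move=> i j ij jm; have im := ltn_trans ij jm.
  have Y0 k w : 0 <= Y k w by exact: one_subr_cos_ge0.
  have -> := ge0_integral_indep (mY i im) (mY j jm) (Y0 i) (Y0 j); first by rewrite !EY.
  move=> C D mC mD.
  have pre (E : set R) : measurable E -> measurable ((fun y => 1 - cos (u * y)) @^-1` E).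
    by move=> mE; rewrite -[_ @^-1` _]setTI; exact: measurable_one_subr_cos.
  apply: (levy_indep_pair lX _ _ _ _ _ (pre C mC) (pre D mD)).
  - exact: dyadic_ge0.
  - exact: dyadic_le.
  - exact: dyadic_le.
  - exact: dyadic_le.
  - by case/andP: (bnd j.+1 jm).
Qed.

(** * Asymptotics for vanishing mesh and for growing frequency *)

Lemma limn_einf_ge (R : realType) (v : nat -> \bar R) (a : \bar R) :
  (\forall n \near \oo, (a <= v n)%E) -> (a <= limn_einf v)%E.
Proof.
move=> [N _ NP]; rewrite limn_einf_lim.
apply: lime_ge; first exact: is_cvg_einfs.
exists N => // n /= Nn; apply: le_ereal_inf_tmp => _ [k /= nk <-].
by apply: NP; exact: leq_trans nk.
Qed.

Lemma limn_einf_le_cvg (R : realType) (v v' : nat -> \bar R) (l : \bar R) :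
  (forall n, (v n <= v' n)%E) -> v' @ \oo --> l -> (limn_einf v <= l)%E.
Proof.
move=> vv' v'l; rewrite limn_einf_lim -(cvg_lim _ v'l)//.
apply: lee_lim; [exact: is_cvg_einfs|by apply/cvg_ex; exists l|].
apply: nearW => n; apply: le_trans (vv' n).
by apply: ereal_inf_lbound; exists n => //=.
Qed.

(** The sequence is [- t] times the difference quotient at [0] of [q], with step [t / 2 ^+ m], and
    [q] has derivative [A] there. The case [t = 0] is separate because the step would vanish. *)
Lemma cos_mean_cvg (R : realType) (A B t : R) : 0 <= t ->
  (2 ^ m)%:R * cos_mean A B (t / 2 ^+ m) @[m --> \oo] --> - t * A.
Proof.
rewrite le_eqVlt => /predU1P[<-|t0].
  rewrite oppr0 mul0r (_ : (fun m => _) = cst 0); first exact: cvg_cst.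
  by apply/funext => m; rewrite /cos_mean !mul0r expR0 cos0 mulr1 subrr mulr0.
pose q (h : R) := expR (h * A) * cos (h * B).
have dq : is_derive (0 : R) 1 q A.
  apply: is_derive_eq; rewrite !mul0r expR0 cos0 sin0 /GRing.scale /=.
  by rewrite !(oppr0, mulr0, mul0r, mulr1, mul1r, add0r, addr0).
have [dq1 dqE] := dq.
have hcvg : (t / 2 ^+ m) @[m --> \oo] --> (0 : R)^'.
  move=> C [e /= e0 HC]; have := dyadic_mesh t e0.
  apply: filterS => m mh; apply: HC => /=.
    by rewrite sub0r normrN gtr0_norm// divr_gt0// exprn_gt0.
  by rewrite gt_eqF// divr_gt0// exprn_gt0.
have := cvg_comp _ _ hcvg dq1; rewrite -/(derive q 0 1) dqE => qc.
have -> : (fun m => (2 ^ m)%:R * cos_mean A B (t / 2 ^+ m)) =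
    (fun m => - t * ((t / 2 ^+ m)^-1 * (q (t / 2 ^+ m) - q 0))).
  apply/funext => m; rewrite /cos_mean /q !mul0r expR0 cos0 mul1r natrX.
  have m0 : (2 : R) ^+ m != 0 by rewrite expf_neq0.
  by field; rewrite m0 gt_eqF.
apply: cvgM; first exact: cvg_cst.
apply: cvg_trans qc; apply: near_eq_cvg; apply: nearW => m /=.
by rewrite addr0 /GRing.scale /= mulr1.
Qed.

(** Dominated convergence removes the jump part: divided by [u ^+ 2], the integrand tends to [0]
    pointwise and is bounded by [2 * Num.min 1 (x ^+ 2)], integrable for a Levy measure. Only the
    Gaussian coefficient survives. *)
Lemma levy_exponent_re_cvg (R : realType) (s2 : R)
    (nu : {measure set (measurableTypeR R) -> \bar R}) :
  levy_measure nu ->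
  2 / u%:R ^+ 2 * - levy_exponent_re s2 nu u%:R @[u --> \oo] --> s2.
Proof.
move=> [_ nufin].
pose g (x : R) : R := 2 * Num.min 1 (x ^+ 2).
have g0 x : 0 <= g x by rewrite mulr_ge0// le_min ler01 sqr_ge0.
have mmin : measurable_fun setT (fun x : R => Num.min 1 (x ^+ 2)).
  by apply: measurable_minr => //; exact: exprn_measurable.
have mg : measurable_fun setT g by exact: measurable_funM.
have ig : nu.-integrable setT (EFin \o g).
  apply/integrableP; split; first exact/measurable_EFinP.
  rewrite (_ : (fun x => _) = (fun x => 2%:E * (Num.min 1 (x ^+ 2))%:E)%E); last first.
    by apply/funext => x /=; rewrite ger0_norm// /g EFinM.
  rewrite ge0_integralZl//.
  - by rewrite lte_mul_pinfty.
  - exact/measurable_EFinP.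
  - by move=> x _; rewrite lee_fin le_min ler01 sqr_ge0.
pose f (u : nat) (x : R) : R := (u%:R ^+ 2)^-1 * (cos (u%:R * x) - 1).
have mcos (u : R) : measurable_fun setT (fun x : R => cos (u * x) - 1).
  have -> : (fun x : R => cos (u * x) - 1) = (fun x => - (1 - cos (u * x))).
    by apply/funext => x; rewrite opprB.
  by apply: measurableT_comp => //; exact: measurable_one_subr_cos.
have mf u : measurable_fun setT (f u) by exact: measurable_funM.
have mfE u : measurable_fun setT (EFin \o f u) by exact/measurable_EFinP.
have u2 (u : nat) : 0 <= (u%:R ^+ 2 : R)^-1 by rewrite invr_ge0 sqr_ge0.
have fabs u x : `|f u x| = (u%:R ^+ 2)^-1 * (1 - cos (u%:R * x)).
  by rewrite normrM ger0_norm// distrC ger0_norm// one_subr_cos_ge0.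
have fg u x : `|f u x| <= g x.
  (* At [u = 0] the convention that the inverse of [0] is [0] makes [f] vanish. *)
  rewrite fabs; case: u => [|u]; first by rewrite expr0n /= invr0 mul0r.
  have u0 : 0 < (u.+1%:R : R) ^+ 2 by rewrite exprn_gt0.
  rewrite /g mulrC ler_pdivrMr//; have [x1|x1] := leP 1 (x ^+ 2).
    have := one_subr_cos_le2 (u.+1%:R * x).
    have : 1 <= (u.+1%:R : R) ^+ 2 by rewrite exprn_ege1// ler1n.
    by lra.
  have := one_subr_cos_le (u.+1%:R * x); rewrite exprMn.
  by have := mulr_ge0 (ltW u0) (sqr_ge0 x); lra.
have f0 x : f u x @[u --> \oo] --> 0.
  apply/cvgrPdist_le => e e0; near=> u.
  have u0 : 0 < u%:R :> R by rewrite ltr0n; near: u; exact: nbhs_infty_gt.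
  have u1 : 1 <= u%:R :> R by rewrite ler1n -(ltr0n R).
  have ue : 2 / e <= u%:R :> R by near: u; exact: nbhs_infty_ger.
  rewrite sub0r normrN fabs mulrC ler_pdivrMr ?exprn_gt0//.
  rewrite (le_trans (one_subr_cos_le2 _))//.
  move: ue; rewrite ler_pdivrMr// mulrC => /le_trans; apply.
  by rewrite ler_pM2l// expr2 ler_pMl.
have [|||||_ _ dct] := @dominated_convergence _ _ R nu setT measurableT
    (fun u => EFin \o f u) (cst 0%E) (EFin \o g).
- by move=> u; exact: mfE.
- exact: measurable_cst.
- by apply: nearW => x _; apply: cvg_EFin; [exact: nearW|exact: f0].
- exact: ig.
- by apply: nearW => x u _; rewrite /= lee_fin.
have Rc : Rintegral nu setT (f u) @[u --> \oo] --> (0 : R).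
  by move: dct; rewrite integral0 => /fine_cvg.
have fi u : nu.-integrable setT (EFin \o f u).
  apply: le_integrable ig => //; first exact: mfE.
  by move=> x _; rewrite /= lee_fin (ger0_norm (g0 _)).
have key u : (0 < u)%N ->
    2 / u%:R ^+ 2 * - levy_exponent_re s2 nu u%:R = s2 - 2 * Rintegral nu setT (f u).
  move=> u0; have uu : (u%:R ^+ 2 : R) != 0 by rewrite expf_neq0// pnatr_eq0 -lt0n.
  have -> : Rintegral nu setT (f u) =
      (u%:R ^+ 2)^-1 * Rintegral nu setT (fun x => cos (u%:R * x) - 1).
    rewrite -RintegralZl//.
    have := integrableZl measurableT (u%:R ^+ 2) (fi u); apply: eq_integrable => //.
    by move=> x _; rewrite /= -EFinM /f mulrA divff ?mul1r.
  by rewrite /levy_exponent_re; field; rewrite pnatr_eq0 -lt0n.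
have : s2 - 2 * Rintegral nu setT (f u) @[u --> \oo] --> s2 - 2 * 0.
  by apply: cvgB; [exact: cvg_cst|apply: cvgM; [exact: cvg_cst|exact: Rc]].
rewrite mulr0 subr0; apply: cvg_trans; apply: near_eq_cvg.
by exists 1%N => // u /= u0; rewrite key.
Unshelve. all: by end_near. Qed.

(** * Identification of the limit of the cosine sums *)

Lemma measurable_fun_limn_einf (d : measure_display) (Omega : measurableType d)
    (R : realType) (f : nat -> Omega -> \bar R) :
  (forall n, measurable_fun setT (f n)) ->
  measurable_fun setT (fun w => limn_einf (f ^~ w)).
Proof.
move=> mf; rewrite /limn_einf.
apply: (@measurableT_comp _ _ _ _ _ _ (@oppe R)); first exact: oppe_measurable.
apply: (@measurable_fun_limn_esup _ _ _ _ (fun n w => - f n w)%E) => n.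
by apply: (@measurableT_comp _ _ _ _ _ _ (@oppe R)).
Qed.

Lemma measurable_dyadic_sum (d : measure_display) (Omega : measurableType d)
    (R : realType) (P : probability Omega R) (T : R) (X : R -> Omega -> R)
    (f : R -> R) (t : R) (m : nat) :
  levy_process P T X -> measurable_fun setT f -> 0 <= t <= T ->
  measurable_fun setT (fun w => dyadic_sum f (X ^~ w) t m).
Proof.
move=> lX mf /andP[t0 tT]; rewrite /dyadic_sum.
under eq_fun do rewrite big_mkord.
apply: measurable_sum => i.
have bnd j : (j <= 2 ^ m)%N -> 0 <= dyadic t m j <= T.
  by move=> jm; rewrite dyadic_ge0//= (le_trans (dyadic_bound t0 jm)).
apply: (@measurableT_comp _ _ _ _ _ _ f) => //.
by apply: measurable_funB; apply: (levy_measurable lX); apply: bnd => //; exact: ltnW.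
Qed.

(* The variance of the cosine sums, divided by [u^4], vanishes as [u --> oo]:
   hence their limits are deterministic. *)
Lemma gaussian_part (d : measure_display) (Omega : measurableType d)
    (R : realType) (P : probability Omega R) (T : R) (X : R -> Omega -> R)
    (s2 t : R) (mk : nat -> nat) :
  levy_process P T X -> gaussian_variance P T X s2 -> 0 <= t <= T ->
  (forall k, (k <= mk k)%N) ->
  \forall w \ae P, forall r : R,
    (forall e : R, 0 < e -> \forall u \near \oo, \forall k \near \oo,
      `|2 / u%:R ^+ 2 *
          dyadic_sum (fun y => 1 - cos (u%:R * y)) (X ^~ w) t (mk k) - r| <= e) ->
    r = s2 * t.
Proof.
move=> lX [_ [g [nu [lnu EX]]]] t0T kmk; have /andP[t0 tT] := t0T.
pose A u := levy_exponent_re s2 nu u%:R.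
pose B u := levy_exponent_im g nu u%:R.
pose c u m := (2 ^ m)%:R * cos_mean (A u) (B u) (t / 2 ^+ m).
pose S (u : nat) m w := dyadic_sum (fun y => 1 - cos (u%:R * y)) (X ^~ w) t m.
pose b (u : nat) : R := 2 / u%:R ^+ 2.
pose D u k w : R := (b u * S u (mk k) w - b u * c u (mk k)) ^+ 2.
have EXu u r : 0 <= r <= T -> ('E_P[fun w => cos (u%:R * X r w)] =
    (expR (r * A u) * cos (r * B u))%:E)%E.
  by move=> r0T; case: (EX r u%:R r0T).
have mS u m : measurable_fun setT (S u m).
  by apply: measurable_dyadic_sum lX _ t0T; exact: measurable_one_subr_cos.
have mD u k : measurable_fun setT (fun w => (D u k w)%:E).
  apply/measurable_EFinP; apply: measurable_funX; apply: measurable_funB => //.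
  exact: measurable_funM.
have D0 u k w : (0 <= (D u k w)%:E)%E by rewrite lee_fin sqr_ge0.
have ID u k : (\int[P]_w (D u k w)%:E <= (b u ^+ 2 * (2 * c u (mk k)))%:E)%E.
  rewrite EFinM.
  apply: le_trans (lee_wpmul2l _ (dyadic_cos_variance (mk k) lX (EXu u) t0T)); last first.
    by rewrite lee_fin sqr_ge0.
  have mq : measurable_fun setT (fun w => ((S u (mk k) w - c u (mk k)) ^+ 2)%:E).
    by apply/measurable_EFinP; apply: measurable_funX; apply: measurable_funB.
  have q0 w : [set: Omega] w -> (0 <= ((S u (mk k) w - c u (mk k)) ^+ 2)%:E)%E.
    by rewrite lee_fin sqr_ge0.
  have b20 : (0 <= (b u ^+ 2)%:E)%E by rewrite lee_fin sqr_ge0.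
  rewrite -(ge0_integralZl P measurableT mq q0 b20).
  rewrite le_eqVlt; apply/orP; left; apply/eqP; apply: eq_integral => w _.
  by rewrite -EFinM /D -mulrBr exprMn.
have c_cvg u : c u (mk k) @[k --> \oo] --> - t * A u.
  apply/cvgrPdist_le => e e0.
  have /cvgrPdist_le/(_ e e0) := @cos_mean_cvg R (A u) (B u) t t0.
  exact: near_subseq.
(* Fatou's lemma is applied first in [k] for fixed [u], then in [u]. The resulting bound tends to
   [0], since [b u * - A u] tends to [s2] while the remaining factor [b u] tends to [0]. *)
pose G u w := limn_einf (fun k => (D u k w)%:E).
have mG u : measurable_fun setT (G u) by exact: measurable_fun_limn_einf.
have G0 u w : (0 <= G u w)%E by apply: limn_einf_ge; exact: nearW.
have IG u : (\int[P]_w G u w <= (b u ^+ 2 * (2 * (- t * A u)))%:E)%E.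
  apply: (le_trans (fatou P measurableT (mD u) (fun k w _ => D0 u k w))).
  apply: limn_einf_le_cvg (ID u) _.
  apply: cvg_EFin; first exact: nearW.
  by apply: cvgM; [exact: cvg_cst|apply: cvgM; [exact: cvg_cst|exact: c_cvg]].
have bA : b u * - A u @[u --> \oo] --> s2 by exact: levy_exponent_re_cvg.
have b0 : b u @[u --> \oo] --> 0.
  apply/cvgrPdist_le => e e0; near=> u.
  have u0 : 0 < u%:R :> R by rewrite ltr0n; near: u; exact: nbhs_infty_gt.
  have u1 : 1 <= u%:R :> R by rewrite ler1n -(ltr0n R).
  have ue : 2 / e <= u%:R :> R by near: u; exact: nbhs_infty_ger.
  rewrite sub0r normrN ger0_norm ?divr_ge0 ?sqr_ge0// ler_pdivrMr ?exprn_gt0//.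
  move: ue; rewrite ler_pdivrMr// mulrC => /le_trans; apply.
  by rewrite ler_pM2l// expr2 ler_pMl.
have IGG : (\int[P]_w limn_einf (G ^~ w) <= 0)%E.
  apply: (le_trans (fatou P measurableT mG (fun u w _ => G0 u w))).
  apply: limn_einf_le_cvg IG _.
  apply: cvg_EFin; first exact: nearW.
  have -> : fine \o (fun u => (b u ^+ 2 * (2 * (- t * A u)))%:E) =
      (fun u => 2 * t * (b u * (b u * - A u))).
    by apply/funext => u /=; ring.
  rewrite -(mulr0 (2 * t)); apply: cvgM; first exact: cvg_cst.
  by rewrite -(mul0r s2); apply: cvgM.
have mGG : measurable_fun setT (fun w => limn_einf (G ^~ w)).
  exact: measurable_fun_limn_einf.
have GG0 w : (0 <= limn_einf (G ^~ w))%E by apply: limn_einf_ge; exact: nearW.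
have : ae_eq P setT (fun w => limn_einf (G ^~ w)) (cst 0%E).
  apply/(ae_eq_integral_abs P measurableT mGG).
  apply/eqP; rewrite eq_le integral_ge0// andbT.
  apply: le_trans IGG; rewrite le_eqVlt; apply/orP; left; apply/eqP.
  by apply: eq_integral => w _; rewrite gee0_abs.
apply: filterS => w /(_ I) /= Gw r Hr; apply/eqP/negPn/negP => rs.
(* Three approximations, each within [e], lie between [r] and [s2 * t], so a deviation of at least
   [e] is left: [D] would be eventually at least [e ^+ 2], against the vanishing of the double limit
   inferior. *)
pose e := `|r - s2 * t| / 4.
have e0 : 0 < e by rewrite divr_gt0// normr_gt0 subr_eq0.
suff : ((e ^+ 2)%:E <= limn_einf (G ^~ w))%E.
  by rewrite Gw lee_fin leNgt exprn_gt0.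
have bAt : b u * (- t * A u) @[u --> \oo] --> s2 * t.
  have -> : (fun u => b u * (- t * A u)) = (fun u => b u * - A u * t).
    by apply/funext => u; ring.
  by apply: cvgM => //; exact: cvg_cst.
apply: limn_einf_ge; near=> u; apply: limn_einf_ge.
have Hru : \forall k \near \oo, `|b u * S u (mk k) w - r| <= e.
  by near: u; exact: Hr.
have au : `|s2 * t - b u * (- t * A u)| <= e.
  by near: u; have /cvgrPdist_le := bAt; exact.
have bcu : \forall k \near \oo, `|b u * (- t * A u) - b u * c u (mk k)| <= e.
  have : b u * c u (mk k) @[k --> \oo] --> b u * (- t * A u).
    by apply: cvgM; [exact: cvg_cst|exact: c_cvg].
  by move/cvgrPdist_le; exact.
move: Hru bcu; apply: filterS2 => k h1 h2.
rewrite lee_fin /D -[leRHS]real_normK ?num_real//.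
rewrite ler_pXn2r ?nnegrE//; last exact: ltW.
have re : `|r - s2 * t| = 4 * e by rewrite /e [RHS]mulrC divfK.
have : `|r - s2 * t| <= `|b u * S u (mk k) w - b u * c u (mk k)| + 3 * e.
  set x := b u * S u (mk k) w in h1 *; set y := b u * c u (mk k) in h2 *.
  set z := b u * _ in h2 au.
  have -> : r - s2 * t = (x - y) - (x - r) - (s2 * t - z) - (z - y) by ring.
  have := ler_normB ((x - y) - (x - r) - (s2 * t - z)) (z - y).
  have := ler_normB ((x - y) - (x - r)) (s2 * t - z).
  have := ler_normB (x - y) (x - r).
  by lra.
by rewrite re; lra.
Unshelve. all: by end_near. Qed.

(** * Random measures *)

(** Choosing [mk k] with integral at most [1 / 2 ^ (k + 1)] makes the series of the [f (mk k)]
    integrable, hence finite almost everywhere, so its terms tend to [0]. *)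
Lemma ae_cvg0_subseq (d : measure_display) (Omega : measurableType d)
    (R : realType) (mu : {measure set Omega -> \bar R})
    (f : nat -> Omega -> \bar R) :
  (forall m, measurable_fun setT (f m)) -> (forall m w, (0 <= f m w)%E) ->
  (\int[mu]_w f m w)%E @[m --> \oo] --> 0%E ->
  exists2 mk : nat -> nat, (forall k, (k <= mk k)%N) &
    \forall w \ae mu, f (mk k) w @[k --> \oo] --> 0%E.
Proof.
move=> mf f0 If.
have /choice[mk mkP] : forall k : nat, exists m, (k <= m)%N /\
    (\int[mu]_w f m w <= (1 / (2 ^ (k + 1))%:R)%:E)%E.
  move=> k; have e0 : 0 < (1 / (2 ^ (k + 1))%:R : R) by rewrite divr_gt0// ltr0n expn_gt0.
  have /fine_cvgP[fin /cvgrPdist_le/(_ _ e0) H] := If.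
  have [N _ NP] := filterI (nbhs_infty_ge k) (filterI fin H).
  have [kN [finN HN]] := NP N (leqnn N).
  exists N; split => //.
  rewrite -(fineK finN) lee_fin; move: HN; rewrite sub0r normrN /=.
  exact: le_trans (ler_norm _).
exists mk; first by move=> k; case: (mkP k).
pose g w := (\sum_(0 <= k <oo) f (mk k) w)%E.
have Ig : (\int[mu]_w g w < +oo)%E.
  rewrite integral_nneseries//.
  apply: (@le_lt_trans _ _ (\sum_(0 <= k <oo) (1 / (2 ^ (k + 1))%:R : R)%:E)%E).
    apply: lee_nneseries => [k *|k *]; first by apply: integral_ge0 => w _.
    by case: (mkP k).
  have := @cvg_geometric_eseries_half R 1 0.
  by move/cvg_lim => ->//; rewrite ltry.
have mg : measurable_fun setT g by apply: ge0_emeasurable_sum => // k w _ _.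
have g0 w : (0 <= g w)%E by apply: nneseries_ge0 => k _ _.
have ig : mu.-integrable setT g.
  apply/integrableP; split => //.
  by under eq_integral do rewrite gee0_abs//.
have := integrable_ae measurableT ig; apply: filterS => w /(_ I) gfin.
have gw : (g w < +oo)%E by rewrite -ge0_fin_numE.
have tail := nneseries_tail_cvg gw (fun k _ => f0 (mk k) w).
apply: (squeeze_cvge _ (cvg_cst 0%E) tail); apply: nearW => N /=.
rewrite f0 /=.
have := @nneseries_lim_ge R (fun k => f (mk k) w) xpredT N N.+1 (fun n _ _ => f0 _ w).
by rewrite big_nat1.
Qed.

Lemma integral_sqr_Lnorm2 (d : measure_display) (Omega : measurableType d)
    (R : realType) (mu : {measure set Omega -> \bar R}) (g : Omega -> R) :
  (\int[mu]_w ((g w) ^+ 2)%:E =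
    'N[mu]_2%:E [EFin \o g] * 'N[mu]_2%:E [EFin \o g])%E.
Proof.
have -> : ('N[mu]_2%:E [EFin \o g] * 'N[mu]_2%:E [EFin \o g] =
    'N[mu]_2%:E [EFin \o g] `^ 2)%E.
  have := Lnorm_ge0 mu 2%:E (EFin \o g); case: ('N[mu]_2%:E [EFin \o g])%E => // [x x0|_].
    by rewrite poweR_EFin powR_mulrn.
  by rewrite mulyy poweRyr.
rewrite poweR_Lnorm//; apply: eq_integral => w _.
by rewrite /= powR_mulrn// real_normK ?num_real.
Qed.

Lemma random_measure_measurable (d : measure_display) (Omega : measurableType d)
    (R : realType) (P : probability Omega R) (d' : measure_display)
    (S : measurableType d') (E : set S) (phi : set S -> Omega -> R) (A : set S) :
  random_measure P E phi -> measurable A -> A `<=` E ->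
  measurable_fun setT (phi A).
Proof.
move=> rm mA AE; have := random_measure_L2 rm mA AE.
by rewrite inE => /andP[+ _]; rewrite inE.
Qed.

Definition disjoint_sequence (d : measure_display) (S : measurableType d)
    (E : set S) (F : nat -> set S) : Prop :=
  [/\ forall i, measurable (F i), forall i, F i `<=` E & trivIset setT F].

(** A single subsequence has to serve both measures, so it is extracted from the sum [h] of the two
    squared errors. *)
Lemma random_measure_subseq2 (d : measure_display) (Omega : measurableType d)
    (R : realType) (P : probability Omega R)
    (d1 d2 : measure_display) (S1 : measurableType d1) (S2 : measurableType d2)
    (E1 : set S1) (E2 : set S2)
    (phi : set S1 -> Omega -> R) (psi : set S2 -> Omega -> R)
    (F : nat -> set S1) (G : nat -> set S2) :
  random_measure P E1 phi -> random_measure P E2 psi ->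
  disjoint_sequence E1 F -> disjoint_sequence E2 G ->
  exists2 mk : nat -> nat, (forall k, (k <= mk k)%N) &
    \forall w \ae P,
      (\sum_(0 <= i < mk k) phi (F i) w @[k --> \oo] --> phi (\bigcup_i F i) w) /\
      (\sum_(0 <= i < mk k) psi (G i) w @[k --> \oo] --> psi (\bigcup_i G i) w).
Proof.
move=> rphi rpsi [mF FE tF] [mG GE tG].
pose f m w := \sum_(i < m) phi (F i) w - phi (\bigcup_i F i) w.
pose g m w := \sum_(i < m) psi (G i) w - psi (\bigcup_i G i) w.
have mf m : measurable_fun setT (f m).
  apply: measurable_funB.
    by apply: measurable_sum => i; exact: random_measure_measurable rphi _ _.
  by apply: (random_measure_measurable rphi); [exact: bigcup_measurable|exact: bigcup_sub].
have mg m : measurable_fun setT (g m).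
  apply: measurable_funB.
    by apply: measurable_sum => i; exact: random_measure_measurable rpsi _ _.
  by apply: (random_measure_measurable rpsi); [exact: bigcup_measurable|exact: bigcup_sub].
pose h m w := ((f m w) ^+ 2 + (g m w) ^+ 2)%:E.
have [|||mk kmk H] := @ae_cvg0_subseq _ _ R P h.
- by move=> m; apply/measurable_EFinP; apply: measurable_funD; apply: measurable_funX.
- by move=> m w; rewrite lee_fin addr_ge0 ?sqr_ge0.
- have sq0 (q : nat -> Omega -> R) :
      'N[P]_2%:E[EFin \o q m]%E @[m --> \oo] --> 0%E ->
      (\int[P]_w ((q m w) ^+ 2)%:E)%E @[m --> \oo] --> 0%E.
    move=> q0; under eq_fun do rewrite integral_sqr_Lnorm2.
    by rewrite -(mule0 0%E); apply: cvgeM.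
  rewrite [X in X @ _ --> _](_ : _ = (fun m =>
      (\int[P]_w ((f m w) ^+ 2)%:E + \int[P]_w ((g m w) ^+ 2)%:E)%E)); last first.
    apply/funext => m; rewrite -ge0_integralD//.
    + by move=> w _; rewrite lee_fin sqr_ge0.
    + by apply/measurable_EFinP; apply: measurable_funX.
    + by move=> w _; rewrite lee_fin sqr_ge0.
    + by apply/measurable_EFinP; apply: measurable_funX.
  rewrite -(adde0 0%E); apply: cvgeD => //.
    exact: sq0 (random_measure_sigma_additive rphi mF FE tF).
  exact: sq0 (random_measure_sigma_additive rpsi mG GE tG).
exists mk => //; move: H; apply: filterS => w /fine_cvgP[_ /cvgrPdist_lt H].
split; apply/cvgrPdist_lt => e e0; have := H (e ^+ 2) (exprn_gt0 _ e0);
    apply: filterS => k; rewrite /= sub0r normrN ger0_norm ?addr_ge0 ?sqr_ge0// => lt.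
- rewrite distrC big_mkord -/(f (mk k) w) -(ltr_pXn2r (n := 2)) ?nnegrE ?(ltW e0)//.
  by rewrite real_normK ?num_real//; have := sqr_ge0 (g (mk k) w); lra.
- rewrite distrC big_mkord -/(g (mk k) w) -(ltr_pXn2r (n := 2)) ?nnegrE ?(ltW e0)//.
  by rewrite real_normK ?num_real//; have := sqr_ge0 (f (mk k) w); lra.
Qed.

(** The constant sequence [set0] is disjoint with union [set0], so unbounded multiples of [phi set0]
    converge to [phi set0]. *)
Lemma random_measure_set0 (d : measure_display) (Omega : measurableType d)
    (R : realType) (P : probability Omega R) (d' : measure_display)
    (S : measurableType d') (E : set S) (phi : set S -> Omega -> R) :
  random_measure P E phi -> \forall w \ae P, phi set0 w = 0.
Proof.
move=> rm.
have ds : disjoint_sequence E (fun=> set0 : set S).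
  split=> [i|i|]; [exact: measurable0|exact: sub0set|].
  by apply/trivIsetP => i j _ _ _; rewrite setI0.
have [mk kmk] := random_measure_subseq2 rm rm ds ds.
apply: filterS => w [+ _]; rewrite bigcup0//.
move=> /cvgrPdist_lt H; apply/eqP/negPn/negP => p0.
have e0 : 0 < `|phi set0 w| by rewrite normr_gt0.
(* An index of at least [2] makes the multiple at least [2], at distance at least [1] from [1]. *)
have [N _ /(_ (maxn N 2) (leq_maxl _ _))] := H _ e0.
rewrite /= sumr_const_nat subn0 -mulr_natl -{1}[phi set0 w]mul1r -mulrBl normrM.
rewrite gtr_pMl// distrC => /(le_lt_trans (ler_norm _)) lt1.
have : (2 : R) <= (mk (maxn N 2))%:R.
  by rewrite ler_nat; apply: leq_trans (kmk _); exact: leq_maxr.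
by lra.
Qed.

Lemma random_measure_finite_sum (d : measure_display)
    (Omega : measurableType d) (R : realType) (P : probability Omega R)
    (d' : measure_display) (S : measurableType d') (E : set S)
    (phi : set S -> Omega -> R) (F : nat -> set S) (N : nat) :
  random_measure P E phi -> disjoint_sequence E F ->
  (forall i, (N <= i)%N -> F i = set0) ->
  \forall w \ae P, phi (\bigcup_i F i) w = \sum_(0 <= i < N) phi (F i) w.
Proof.
move=> rm ds F0; have [mk kmk H] := random_measure_subseq2 rm rm ds ds.
have := random_measure_set0 rm; move: H; apply: filterS2 => w [H _] phi0.
apply: (cvg_unique _ H) => //=.
apply: cvg_near_cst; exists N => // k /= Nk.
rewrite (big_cat_nat (n := N))//= ?(leq_trans Nk)// [X in _ + X]big_nat_cond.
rewrite [X in _ + X]big1 ?addr0// => i /andP[/andP[Ni _] _].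
by rewrite F0.
Qed.

Lemma random_measure_setD (d : measure_display) (Omega : measurableType d)
    (R : realType) (P : probability Omega R) (d' : measure_display)
    (S : measurableType d') (E : set S) (phi : set S -> Omega -> R)
    (A B : set S) :
  random_measure P E phi -> measurable A -> measurable B ->
  A `<=` E -> B `<=` A ->
  \forall w \ae P, phi (A `\` B) w = phi A w - phi B w.
Proof.
move=> rm mA mB AE BA.
pose F := bigcup2 B (A `\` B).
have ds : disjoint_sequence E F.
  rewrite /F; split=> [[|[|i]]|[|[|i]]|] //=.
  - exact: measurableD.
  - exact: subset_trans AE.
  - by apply: subset_trans AE; exact: subDsetl.
  - by rewrite -trivIset_bigcup2; exact: setDIK.
have F0 i : (2 <= i)%N -> F i = set0 by case: i => [|[|]].
have := random_measure_finite_sum rm ds F0; apply: filterS => w.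
rewrite bigcup2E setDUK// => ->.
by rewrite /= big_nat_recr// big_nat1/= addrC addrK.
Qed.

(** This prepares continuity from above: the layers of a decreasing sequence are disjoint, with
    union [D 0] minus the intersection, so sigma-additivity controls [D m] through telescoping
    sums. *)
Lemma random_measure_telescope (d : measure_display) (Omega : measurableType d)
    (R : realType) (P : probability Omega R) (d' : measure_display)
    (S : measurableType d') (E : set S) (phi : set S -> Omega -> R)
    (D : nat -> set S) :
  random_measure P E phi -> (forall m, measurable (D m)) -> D 0%N `<=` E ->
  (forall m, D m.+1 `<=` D m) ->
  disjoint_sequence E (fun m => D m `\` D m.+1) /\
  \forall w \ae P,
    (forall m, \sum_(0 <= i < m) phi (D i `\` D i.+1) w = phi (D 0%N) w - phi (D m) w) /\
    phi (\bigcup_i (D i `\` D i.+1)) w = phi (D 0%N) w - phi (\bigcap_m D m) w.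
Proof.
move=> rm mD DE dD.
have decr m n : (m <= n)%N -> D n `<=` D m.
  elim: n => [|n IHn]; first by rewrite leqn0 => /eqP ->.
  rewrite leq_eqVlt => /predU1P[->//|/IHn]; exact: subset_trans.
have DmE m : D m `<=` E by apply: subset_trans DE; exact: decr.
have ds : disjoint_sequence E (fun m => D m `\` D m.+1).
  split.
  - by move=> i; exact: measurableD.
  - by move=> i; apply: subset_trans (DmE i); exact: subDsetl.
  - apply/trivIsetP => i j _ _; wlog ij : i j / (i < j)%N.
      move=> H; rewrite neq_ltn => /orP[] ij; [apply: H|rewrite setIC; apply: H];
        by rewrite // ?neq_ltn ij ?orbT.
    by move=> _; rewrite -subset0 => x [[_ nDx] [Dx _]]; apply: nDx; exact: decr Dx.
split=> //.
have E1 : \forall w \ae P, forall m, phi (D m `\` D m.+1) w = phi (D m) w - phi (D m.+1) w.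
  by apply/ae_foralln => m; exact: random_measure_setD rm _ _ _ _.
have -> : \bigcup_i (D i `\` D i.+1) = D 0%N `\` \bigcap_m D m.
  apply/seteqP; split => x /=.
    move=> [i _ [Dx nDx]]; split; first exact: decr Dx.
    by move=> /(_ i.+1 I).
  move=> [D0 /existsNP[m /not_implyP[_ nDm]]].
  have ex : exists m, `[<~ D m x>] by exists m; apply/asboolP.
  case: (ex_minnP ex) => -[|i] /asboolP nD imin; first by exfalso.
  exists i => //; split=> //; apply: contrapT => /asboolP/imin.
  by rewrite ltnn.
have E2 : \forall w \ae P, phi (D 0%N `\` \bigcap_m D m) w = phi (D 0%N) w - phi (\bigcap_m D m) w.
  apply: (random_measure_setD rm) => //; first exact: bigcap_measurable.
  by move=> x; apply.
move: E1 E2; apply: filterS2 => w E1 E2; split=> // m.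
elim: m => [|m IHm]; first by rewrite big_geq// subrr.
by rewrite big_nat_recr//= IHm E1 addrA subrK.
Qed.

Lemma random_measure_bigcap_subseq2 (d : measure_display)
    (Omega : measurableType d) (R : realType) (P : probability Omega R)
    (d1 d2 : measure_display) (S1 : measurableType d1) (S2 : measurableType d2)
    (E1 : set S1) (E2 : set S2)
    (phi : set S1 -> Omega -> R) (psi : set S2 -> Omega -> R)
    (D : nat -> set S1) (G : nat -> set S2) :
  random_measure P E1 phi -> random_measure P E2 psi ->
  (forall m, measurable (D m)) -> D 0%N `<=` E1 -> (forall m, D m.+1 `<=` D m) ->
  (forall m, measurable (G m)) -> G 0%N `<=` E2 -> (forall m, G m.+1 `<=` G m) ->
  exists2 mk : nat -> nat, (forall k, (k <= mk k)%N) &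
    \forall w \ae P,
      (phi (D (mk k)) w @[k --> \oo] --> phi (\bigcap_m D m) w) /\
      (psi (G (mk k)) w @[k --> \oo] --> psi (\bigcap_m G m) w).
Proof.
move=> rphi rpsi mD DE dD mG GE dG.
have [dsD aeD] := random_measure_telescope rphi mD DE dD.
have [dsG aeG] := random_measure_telescope rpsi mG GE dG.
have [mk kmk H] := random_measure_subseq2 rphi rpsi dsD dsG.
exists mk => //; move: aeD aeG H; apply: filterS3 => w [sD uD] [sG uG] [HD HG].
split.
- have -> : (fun k => phi (D (mk k)) w) = (fun k => phi (D 0%N) w -
      \sum_(0 <= i < mk k) phi (D i `\` D i.+1) w).
    by apply/funext => k; rewrite sD subKr.
  rewrite -[phi (\bigcap__ _) w](subKr (phi (D 0%N) w)) -uD.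
  by apply: cvgB; [exact: cvg_cst|exact: HD].
- have -> : (fun k => psi (G (mk k)) w) = (fun k => psi (G 0%N) w -
      \sum_(0 <= i < mk k) psi (G i `\` G i.+1) w).
    by apply/funext => k; rewrite sG subKr.
  rewrite -[psi (\bigcap__ _) w](subKr (psi (G 0%N) w)) -uG.
  by apply: cvgB; [exact: cvg_cst|exact: HG].
Qed.

(** * Dyadic neighbourhoods of the diagonal *)

Lemma measurable_box (d : measure_display) (S : measurableType d) (n : nat)
    (A : 'I_n -> set S) :
  (forall i, measurable (A i)) -> measurable (box A).
Proof.
move=> mA.
have -> : box A =
    \bigcap_(i in [set: 'I_n]) ((fun x : n.-tuple S => tnth x i) @^-1` A i).
  by apply/seteqP; split => x /= H i => [_|]; [exact: H|exact: (H i I)].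
apply: fin_bigcap_measurable => // i _.
by rewrite -[X in measurable X]setTI; apply: measurable_tnth.
Qed.

Definition dyadic_diagonal (R : realType) (n : nat) (t : R) (m : nat)
    : set (n.-tuple (measurableTypeR R)) :=
  \bigcup_(i in [set i | (i < 2 ^ m)%N])
    box (fun=> `]dyadic t m i, dyadic t m i.+1]%classic).

Lemma measurable_dyadic_diagonal (R : realType) (n : nat) (t : R) (m : nat) :
  measurable (@dyadic_diagonal R n t m).
Proof.
by apply: bigcup_measurable => i _; apply: measurable_box => j; exact: measurable_itv.
Qed.

Lemma dyadic_double (R : realType) (t : R) (m i : nat) :
  dyadic t m.+1 i.*2 = dyadic t m i.
Proof.
rewrite /dyadic exprS -mul2n natrM; have m0 : (2 : R) ^+ m != 0 by rewrite expf_neq0.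
by field.
Qed.

Lemma dyadic_diagonal_decr (R : realType) (n : nat) (t : R) (m : nat) :
  0 <= t -> @dyadic_diagonal R n t m.+1 `<=` @dyadic_diagonal R n t m.
Proof.
(* Interval [i] of level [m.+1] is one half of interval [i./2] of level [m]. *)
move=> t0 x [i /= im xi]; exists i./2.
  by rewrite /=; move: im; rewrite expnS; lia.
move=> j; have := xi j; rewrite /= !in_itv/= => /andP[x1 x2].
rewrite -!(dyadic_double t m); apply/andP; split.
  by apply: le_lt_trans x1; apply: dyadic_le => //; lia.
by apply: (le_trans x2); apply: dyadic_le => //; lia.
Qed.

(** Coordinates that share an interval at every level differ by at most every mesh, hence coincide;
    level [0] confines them to [(0, t]]. Conversely a common value lies in one interval of each
    level. *)
Lemma bigcap_dyadic_diagonal (R : realType) (n : nat) (t : R) :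
  (0 < n)%N -> 0 <= t ->
  \bigcap_m @dyadic_diagonal R n t m =
  @tuple_diagonal (measurableTypeR R) n `]0, t]%classic.
Proof.
move=> n0 t0; apply/seteqP; split => x.
  move=> H; split.
    move=> j; have [i /= im /(_ j)] := H 0%N I; rewrite /= !in_itv/=.
    by move: im; rewrite expn0 ltnS leqn0 => /eqP ->; rewrite dyadic0 -(expn0 2) dyadic_last.
  move=> i j; apply/eqP/negPn/negP => ij.
  have /(dyadic_mesh t)[N _ /(_ N (leqnn N)) /=] : 0 < `|tnth x i - tnth x j| :> R.
    by rewrite normr_gt0 subr_eq0.
  apply/negP; rewrite -leNgt; have [k _ xk] := H N I.
  have := xk i; have := xk j; rewrite /= !in_itv/= dyadicS => /andP[? ?] /andP[? ?].
  by rewrite ler_distl; apply/andP; split; lra.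
move=> [xt xx] m _; pose i0 := Ordinal n0.
have := xt i0; rewrite /= in_itv/= => /(dyadic_index m)[i im ii].
by exists i => // j; rewrite /= in_itv/= (xx j i0).
Qed.

(** * The diagonal of a tensor power *)

(** The boxes of one level are disjoint, so [Phi] is additive over them, and on each box it is a
    product of [n] equal increments of [X]. *)
Lemma tensor_dyadic_sum (d : measure_display) (Omega : measurableType d)
    (R : realType) (P : probability Omega R) (T t : R) (X : R -> Omega -> R)
    (phi : set (measurableTypeR R) -> Omega -> R) (n : nat)
    (Phi : set (n.-tuple (measurableTypeR R)) -> Omega -> R) :
  (0 < n)%N -> 0 <= t <= T -> tensor_power P T phi Phi ->
  (forall s t, 0 <= s -> s <= t -> t <= T ->
     \forall w \ae P, phi `]s, t]%classic w = X t w - X s w) ->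
  \forall w \ae P, forall m, Phi (@dyadic_diagonal R n t m) w =
    dyadic_sum (fun y => y ^+ n) (X ^~ w) t m.
Proof.
move=> n0 /andP[t0 tT] [rPhi PhiE] phiX; apply/ae_foralln => m.
have T0 : 0 <= T by lra.
pose I i : set (measurableTypeR R) := `]dyadic t m i, dyadic t m i.+1]%classic.
have mI i : measurable (I i) by exact: measurable_itv.
have IT i : (i < 2 ^ m)%N -> I i `<=` `[0, T]%classic.
  move=> im x; rewrite /I /= !in_itv/= => /andP[x1 x2].
  have := dyadic_ge0 m i t0; have := dyadic_bound t0 im.
  by move=> h1 h2; apply/andP; split; lra.
pose F i : set (n.-tuple (measurableTypeR R)) :=
  if (i < 2 ^ m)%N then box (fun=> I i) else set0.
have FE : \bigcup_i F i = @dyadic_diagonal R n t m.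
  apply/seteqP; split => x.
    by move=> [i _]; rewrite /F; case: ifP => // im xi; exists i.
  by move=> [i /= im xi]; exists i => //; rewrite /F im.
have ds : disjoint_sequence (box (fun=> `[0, T]%classic : set (measurableTypeR R))) F.
  split.
  - move=> i; rewrite /F; case: ifP => // _; exact: measurable_box.
  - move=> i; rewrite /F; case: ifP => [im x xi j|_]; last exact: sub0set.
    exact: IT im _ (xi j).
  - apply/trivIsetP => i j _ _; wlog ij : i j / (i < j)%N.
      move=> H; rewrite neq_ltn => /orP[] ij; [apply: H|rewrite setIC; apply: H];
        by rewrite // ?neq_ltn ij ?orbT.
    move=> _; rewrite -subset0 => x [].
    rewrite /F; case: ifP => // _; case: ifP => // _ /(_ (Ordinal n0)) + /(_ (Ordinal n0)).
    rewrite /I /= !in_itv/= => /andP[_ x1] /andP[x2 _].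
    by have := dyadic_le m t0 ij; lra.
have F0 i : (2 ^ m <= i)%N -> F i = set0 by rewrite /F ltnNge => ->.
have H1 : \forall w \ae P, forall i, (i < 2 ^ m)%N ->
    Phi (box (fun=> I i)) w = \prod_(j < n) phi (I i) w.
  apply/ae_foralln => i; have [im|_] := ltnP i (2 ^ m); last exact: nearW.
  have := PhiE (fun=> I i) (fun=> mI i) (fun=> IT i im).
  by apply: filterS => w ->.
have H2 : \forall w \ae P, forall i, (i < 2 ^ m)%N ->
    phi (I i) w = dyadic_incr (X ^~ w) t m i.
  apply/ae_foralln => i; have [im|_] := ltnP i (2 ^ m); last exact: nearW.
  have := phiX (dyadic t m i) (dyadic t m i.+1) (dyadic_ge0 m i t0)
    (dyadic_le m t0 (leqnSn i)) (le_trans (dyadic_bound t0 im) tT).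
  by apply: filterS => w ->.
have := random_measure_finite_sum rPhi ds F0; rewrite FE.
move: H1 H2; apply: filterS3 => w H1 H2 ->.
apply: eq_big_nat => i /andP[_ im]; rewrite /F im H1// H2//.
by rewrite prodr_const card_ord.
Qed.

Lemma levy_variation0 (Omega : Type) (R : realType) (X : R -> Omega -> R)
    (s2 : R) (n : nat) (w : Omega) :
  (2 <= n)%N -> levy_variation X s2 n 0 w = 0.
Proof.
have rs (f : R -> R) : rsum `]0, (0 : R)]%classic f = 0.
  by rewrite /rsum set_itv_ge ?bnd_simp ?ltxx// !esum_set0 subrr.
by case: n => [|[|[|n]]] //= _; rewrite rs// mulr0 addr0.
Qed.

Lemma cvgn_bounded (R : realType) (v : nat -> R) (l : R) :
  v @ \oo --> l -> exists V, forall k, v k <= V.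
Proof.
move=> vl; have /cvg_seq_bounded[M [_ MP]] : cvgn v by apply/cvg_ex; exists l.
exists (M + 1) => k; have := MP (M + 1) ltac:(lra) k I.
exact: le_trans (ler_norm _).
Qed.

(** The tensor power of order [2] enters for every [n]: along the common subsequence the sums of
    squares converge, hence are bounded, and this bound controls the small increments. *)
Lemma diagonal_measure_itv (d : measure_display) (Omega : measurableType d)
    (R : realType) (P : probability Omega R) (T t s2 : R) (X : R -> Omega -> R)
    (phi : set (measurableTypeR R) -> Omega -> R) (n : nat)
    (Phi2 : set (2.-tuple (measurableTypeR R)) -> Omega -> R)
    (Phi : set (n.-tuple (measurableTypeR R)) -> Omega -> R) :
  (2 <= n)%N -> 0 <= t <= T -> levy_process P T X ->
  gaussian_variance P T X s2 ->
  tensor_power P T phi Phi2 -> tensor_power P T phi Phi ->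
  (forall s t, 0 <= s -> s <= t -> t <= T ->
     \forall w \ae P, phi `]s, t]%classic w = X t w - X s w) ->
  \forall w \ae P, diagonal_measure Phi `]0, t]%classic w =
    levy_variation X s2 n t w.
Proof.
move=> n2 t0T lX gX tP2 tPn phiX; have /andP[t0 tT] := t0T.
have n0 : (0 < n)%N by exact: ltnW.
have D0E q : @dyadic_diagonal R q t 0 `<=` box (fun=> `[0, T]%classic : set (measurableTypeR R)).
  move=> x [i /= im xi] j; have := xi j; rewrite /= !in_itv/= => /andP[x1 x2].
  have := dyadic_ge0 0 i t0; have := dyadic_bound t0 im.
  by move=> h1 h2; apply/andP; split; lra.
have [mk kmk Hmk] := random_measure_bigcap_subseq2 tP2.1 tPn.1
  (@measurable_dyadic_diagonal R 2 t) (D0E 2%N)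
  (fun m => @dyadic_diagonal_decr R 2 t m t0)
  (@measurable_dyadic_diagonal R n t) (D0E n)
  (fun m => @dyadic_diagonal_decr R n t m t0).
have aeS2 := tensor_dyadic_sum (isT : (0 < 2)%N) t0T tP2 phiX.
have aeSn := tensor_dyadic_sum n0 t0T tPn phiX.
have aeG := gaussian_part lX gX t0T kmk.
have aeC := levy_cadlag lX.
have aeS : \forall w \ae P,
    (dyadic_sum (fun y => y ^+ 2) (X ^~ w) t (mk k) @[k --> \oo] -->
       diagonal_measure Phi2 `]0, t]%classic w) /\
    (dyadic_sum (fun y => y ^+ n) (X ^~ w) t (mk k) @[k --> \oo] -->
       diagonal_measure Phi `]0, t]%classic w).
  move: Hmk aeS2 aeSn; apply: filterS3 => w [HQ Hn] S2 Sn.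
  rewrite /diagonal_measure -!bigcap_dyadic_diagonal//; split.
    by apply: cvg_trans HQ; apply: near_eq_cvg; apply: nearW => k; rewrite S2.
  by apply: cvg_trans Hn; apply: near_eq_cvg; apply: nearW => k; rewrite Sn.
move: aeS aeG aeC; apply: filterS3 => w.
set Q := diagonal_measure Phi2 _ w; set Z := diagonal_measure Phi _ w.
move=> [HQ Hn] HG cx.
have [V SV] := cvgn_bounded HQ.
have [n3|n3] := leqP 3 n.
  transitivity (rsum `]0, t]%classic (fun s => jump (X ^~ w) s ^+ n)).
    exact: cvg_unique Hn (dyadic_sum_pow_cvg cx t0T kmk SV n3).
  by clear - n3; case: n n3 => [|[|[|]]].
have n2E : n = 2%N by apply/eqP; rewrite eqn_leq n2 -ltnS n3.
(* [Phi] and [Phi2] may be different representatives, but for [n = 2] their diagonals are limits of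
   the same sums. *)
have -> : Z = Q.
  move: Hn; clearbody Z; rewrite n2E => Hn; exact: cvg_unique Hn HQ.
rewrite n2E /=; set J := rsum _ _.
(* The scaled cosine sums approach [Q - J] in the iterated limit, which [gaussian_part]
   identifies. *)
suff : Q - J = s2 * t by lra.
apply: HG => e e0; have e20 : 0 < e / 2 by rewrite divr_gt0.
have := dyadic_sum_cos_net cx t0T kmk SV e20; apply: filterS => u.
have /cvgrPdist_le/(_ _ e20) := HQ; apply: filterS2 => k.
rewrite -/J !ler_norml => /andP[? ?] /andP[? ?]; apply/andP; split; lra.
Qed.

(** * From intervals to Borel sets *)

Lemma random_measure_unique (d : measure_display) (Omega : measurableType d)
    (R : realType) (P : probability Omega R) (T : R)
    (phi psi : set (measurableTypeR R) -> Omega -> R) :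
  0 <= T ->
  random_measure P (`[0, T]%classic : set (measurableTypeR R)) phi ->
  random_measure P (`[0, T]%classic : set (measurableTypeR R)) psi ->
  (\forall w \ae P, phi [set 0] w = 0) -> (\forall w \ae P, psi [set 0] w = 0) ->
  (forall t, 0 <= t <= T ->
    \forall w \ae P, phi `]0, t]%classic w = psi `]0, t]%classic w) ->
  forall A : set (measurableTypeR R), measurable A -> A `<=` `[0, T]%classic ->
  \forall w \ae P, phi A w = psi A w.
Proof.
move=> T0 rphi rpsi phi0 psi0 eqt.
pose I : set (measurableTypeR R) := `]0, T]%classic.
have mI : measurable I by exact: measurable_itv.
have IE : I `<=` `[0, T]%classic by exact: subset_itv_oc_cc.
have sub x : 0 <= x <= T -> (`]0, x]%classic : set R) `<=` `[0, T]%classic.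
  by move=> x0T y; rewrite /= !in_itv/= => /andP[? ?]; apply/andP; split; lra.
have key A : measurable A -> \forall w \ae P, phi (A `&` I) w = psi (A `&` I) w.
  (* Half-open intervals are stable under intersection and generate the Borel sets. Countable
     disjoint unions use a common subsequence along which both sums converge almost everywhere. *)
  move=> mA; apply: (@dynkin_induction _ (measurableTypeR R) (@ocitv R)
    (fun A => \forall w \ae P, phi (A `&` I) w = psi (A `&` I) w)) mA => //.
  - exact: ocitvI.
  - by rewrite setTI; apply: eqt; rewrite T0 lexx.
  - move=> _ [[a b] _ <-] /=.
    (* Clipped to [[0, T]], the interval is a difference of two intervals starting at [0], where the
       measures agree. *)
    pose a' := Num.max a 0; pose b' := Num.min b T.
    have a'0 : 0 <= a' by rewrite le_max lexx orbT.
    have b'T : b' <= T by rewrite ge_min lexx orbT.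
    have -> : `]a, b]%classic `&` I = `]a', b']%classic.
      apply/seteqP; split => x; rewrite /I /= !in_itv/= gt_max le_min.
        by move=> [/andP[-> ->] /andP[-> ->]].
      by move=> /andP[/andP[-> ->] /andP[-> ->]].
    have [ab|ba] := leP a' b'; last first.
      rewrite set_itv_ge ?bnd_simp -?leNgt ?ltW//.
      have := random_measure_set0 rphi; have := random_measure_set0 rpsi.
      by apply: filterS2 => w -> ->.
    have -> : `]a', b']%classic = `]0, b']%classic `\` `]0, a']%classic :> set R.
      apply/seteqP; split => x; rewrite /= !in_itv/=.
        move=> /andP[? ?]; split; first by apply/andP; split; lra.
        by apply/negP; rewrite negb_and -!leNgt -ltNge; lra.
      move=> [/andP[x0 xb] /negP]; rewrite x0 /= -ltNge => ->.
      by rewrite xb.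
    have a0T : 0 <= a' <= T by lra.
    have b0T : 0 <= b' <= T by lra.
    have sab : (`]0, a']%classic : set (measurableTypeR R)) `<=` `]0, b']%classic.
      by move=> x; rewrite /= !in_itv/= => /andP[-> h] /=; lra.
    have ma : measurable (`]0, a']%classic : set (measurableTypeR R)) by exact: measurable_itv.
    have mb : measurable (`]0, b']%classic : set (measurableTypeR R)) by exact: measurable_itv.
    have eqab : \forall w \ae P,
        phi `]0, b']%classic w - phi `]0, a']%classic w =
        psi `]0, b']%classic w - psi `]0, a']%classic w.
      by have := eqt _ b0T; have := eqt _ a0T; apply: filterS2 => w -> ->.
    have := random_measure_setD rphi mb ma (sub _ b0T) sab.
    have := random_measure_setD rpsi mb ma (sub _ b0T) sab.
    by move: eqab; apply: filterS3 => w E -> ->.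
  - move=> S mS eqS.
    have mSI : measurable (S `&` I) by exact: measurableI.
    have -> : ~` S `&` I = I `\` (S `&` I) by rewrite setDIr setDv setU0 setIC setDE.
    have TT : 0 <= T <= T by rewrite T0 lexx.
    have := random_measure_setD rphi mI mSI IE (@subIsetr _ _ _).
    have := random_measure_setD rpsi mI mSI IE (@subIsetr _ _ _).
    have eqIS : \forall w \ae P,
        phi I w - phi (S `&` I) w = psi I w - psi (S `&` I) w.
      by have := eqt _ TT; move: eqS; apply: filterS2 => w -> ->.
    by move: eqIS; apply: filterS3 => w E -> ->.
  - move=> F mF tF eqF; rewrite setI_bigcupl.
    have ds : disjoint_sequence (`[0, T]%classic : set (measurableTypeR R)) (fun i => F i `&` I).
      split.
      + by move=> i; exact: measurableI.
      + by move=> i; apply: subset_trans IE; exact: subIsetr.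
      + exact: trivIset_setIr.
    have [mk kmk H] := random_measure_subseq2 rphi rpsi ds ds.
    have : \forall w \ae P, forall i, phi (F i `&` I) w = psi (F i `&` I) w.
      by apply/ae_foralln.
    move: H; apply: filterS2 => w -[H1 H2] E.
    apply: (cvg_unique _ H1) => //; apply: cvg_trans H2; apply: near_eq_cvg.
    by apply: nearW => k; apply: eq_bigr => i _; rewrite E.
move=> A mA AT.
have mAI : measurable (A `&` I) by exact: measurableI.
(* What [A] has outside [(0, T]] is at most the point [0], where the measures vanish by
   assumption. *)
have rest (chi : set (measurableTypeR R) -> Omega -> R) :
    random_measure P (`[0, T]%classic : set (measurableTypeR R)) chi ->
    (\forall w \ae P, chi [set 0] w = 0) ->
    \forall w \ae P, chi A w = chi (A `&` I) w.
  move=> rchi chi0.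
  have := random_measure_setD rchi mA mAI AT (@subIsetl _ _ _).
  have := random_measure_set0 rchi; move: chi0; apply: filterS3 => w c0 c1 /eqP.
  have [A0|A0] := pselect (A 0).
    have -> : A `\` (A `&` I) = [set 0].
      apply/seteqP; split => x /=.
        move=> [Ax nI]; have := AT _ Ax; rewrite /= in_itv/= => /andP[x0 xT].
        apply/eqP; rewrite eq_le x0 andbT leNgt; apply/negP => x0'.
        by apply: nI; split => //; rewrite /I /= in_itv/= x0' xT.
      by move=> ->; split => // -[_]; rewrite /I /= in_itv/= ltxx.
    by rewrite c0 eq_sym subr_eq0 => /eqP.
  have -> : A `\` (A `&` I) = set0.
    rewrite -subset0 => x [Ax nI]; have := AT _ Ax; rewrite /= in_itv/= => /andP[x0 xT].
    apply: nI; split => //; rewrite /I /= in_itv/= xT andbT lt_neqAle x0 andbT.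
    by apply/eqP => x0E; apply: A0; rewrite x0E.
  by rewrite c1 eq_sym subr_eq0 => /eqP.
have := key A mA; have := rest _ rpsi psi0; have := rest _ rphi phi0.
by apply: filterS3 => w -> ->.
Qed.

(** The diagonal of [(0, T]] is a countable intersection of unions of boxes; the origin, which these
    half-open boxes miss, is added as a box of its own. *)
Lemma measurable_tuple_diagonal (R : realType) (T : R) (n : nat)
    (A : set (measurableTypeR R)) :
  (0 < n)%N -> 0 <= T -> measurable A -> A `<=` `[0, T]%classic ->
  measurable (@tuple_diagonal (measurableTypeR R) n A).
Proof.
move=> n0 T0 mA AT.
have -> : @tuple_diagonal (measurableTypeR R) n A = box (fun=> A) `&`
    (\bigcap_m @dyadic_diagonal R n T m `|` box (fun=> [set 0])).
  rewrite bigcap_dyadic_diagonal//; apply/seteqP; split => x.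
    move=> [xA xx]; split => //; pose i0 := Ordinal n0.
    have [x0|x0] := eqVneq (tnth x i0 : R) 0.
      by right => i /=; rewrite (xx i i0).
    left; split=> // i; rewrite (xx i i0) /= in_itv/=.
    have := AT _ (xA i0); rewrite /= in_itv/= => /andP[h ->].
    by rewrite lt_neqAle eq_sym x0 h.
  move=> [xA [[_ xx]|x0]]; split => // i j.
  by rewrite (x0 i) (x0 j).
apply: measurableI; first exact: measurable_box.
apply: measurableU.
  by apply: bigcap_measurable => // m _; exact: measurable_dyadic_diagonal.
by apply: measurable_box => i; exact: measurable_set1.
Qed.

(** Equality of all coordinates makes the diagonal of a union the union of the diagonals, and keeps
    diagonals of disjoint sets disjoint, so sigma-additivity is inherited from [Phi]. *)
Lemma diagonal_random_measure (d : measure_display) (Omega : measurableType d)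
    (R : realType) (P : probability Omega R) (T : R) (n : nat)
    (Phi : set (n.-tuple (measurableTypeR R)) -> Omega -> R) :
  (0 < n)%N -> 0 <= T ->
  random_measure P (box (fun=> `[0, T]%classic : set (measurableTypeR R))) Phi ->
  random_measure P (`[0, T]%classic : set (measurableTypeR R))
    (diagonal_measure Phi).
Proof.
move=> n0 T0 rPhi; split.
  move=> A mA AT; apply: (random_measure_L2 rPhi).
    exact: measurable_tuple_diagonal mA AT.
  by move=> x [xA _] i; exact: AT (xA i).
move=> F mF FT tF; pose i0 := Ordinal n0.
have -> : diagonal_measure Phi (\bigcup_i F i) =
    Phi (\bigcup_i @tuple_diagonal (measurableTypeR R) n (F i)).
  congr Phi; apply/seteqP; split => x.
    move=> [xF xx]; have [k _ xk] := xF i0; exists k => //; split=> // i.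
    by rewrite (xx i i0).
  by move=> [k _ [xk xx]]; split=> // i; exists k.
apply: (random_measure_sigma_additive rPhi).
- by move=> i; exact: measurable_tuple_diagonal (mF i) (FT i).
- by move=> i x [xF _] j; exact: FT (xF j).
- move=> i j _ _ [x [[xi _] [xj _]]]; apply: tF => //.
  by exists (tnth x i0); split; [exact: xi|exact: xj].
Qed.

Theorem proposition3p3 (R : realType) (d : measure_display)
    (Omega : measurableType d) (P : probability Omega R)
    (completeP : measure_is_complete P)
    (T : R) (T_gt0 : 0 < T) (X : R -> Omega -> R)
    (levyX : levy_process P T X) (momX : moments_of_all_orders P T X)
    (sigmaG2 : R) (gaussX : gaussian_variance P T X sigmaG2)
    (phi : nat -> set (measurableTypeR R) -> Omega -> R)
    (phiP : forall n : nat, (1 <= n)%N ->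
       induced_measure P T (levy_variation X sigmaG2 n) (phi n))
    (Phi : forall n : nat, set (n.-tuple (measurableTypeR R)) -> Omega -> R)
    (PhiP : forall n : nat, (1 <= n)%N -> tensor_power P T (phi 1%N) (Phi n)) :
  forall A : set (measurableTypeR R), measurable A -> A `<=` `[0, T]%classic ->
  forall n : nat, (1 <= n)%N ->
    \forall w \ae P, diagonal_measure (Phi n) A w = phi n A w.
Proof.
move=> A mA AT n n1; have T0 := ltW T_gt0.
have [_ phiX phi1_0] := phiP 1%N isT.
have boxE (B : set (measurableTypeR R)) : measurable B -> B `<=` `[0, T]%classic ->
    \forall w \ae P, Phi n (box (fun=> B)) w = phi 1%N B w ^+ n.
  move=> mB BT; have := (PhiP n n1).2 (fun=> B) (fun=> mB) (fun=> BT).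
  by apply: filterS => w ->; rewrite prodr_const card_ord.
(* For [n = 1] the diagonal condition is vacuous and the tensor power on a box is [phi 1] itself. *)
have [n2|n2] := leqP 2 n; last first.
  have nE : n = 1%N by apply/eqP; rewrite eqn_leq n1 -ltnS n2.
  have dA : @tuple_diagonal (measurableTypeR R) n A = box (fun=> A).
    apply/seteqP; split => x; first by case.
    move=> xA; split => // i j; congr (tnth x _); apply: val_inj.
    by have := ltn_ord i; have := ltn_ord j; rewrite /=; lia.
  have := boxE A mA AT; rewrite /diagonal_measure dA.
  by apply: filterS => w ->; rewrite nE expr1.
(* For [2 <= n] both sides are random measures, so it suffices to compare them on the point [0] and
   on the intervals [(0, t]]. *)
have [rphi phiE phi_0] := phiP n n1.
have rPhi := diagonal_random_measure n1 T0 (PhiP n n1).1.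
apply: (random_measure_unique T0 rPhi rphi) => //.
- have dA : @tuple_diagonal (measurableTypeR R) n [set 0] = box (fun=> [set 0]).
    apply/seteqP; split => x; first by case.
    by move=> x0; split => // i j; rewrite (x0 i) (x0 j).
  have m0 : measurable ([set 0] : set (measurableTypeR R)) by exact: measurable_set1.
  have := boxE [set 0] m0; rewrite /diagonal_measure dA => H.
  have {}H := H ltac:(by move=> x ->; rewrite /= in_itv/= lexx T0).
  move: H phi1_0; apply: filterS2 => w -> ->; rewrite expr0n.
  by case: (n) n1.
- move=> t t0T; have /andP[t0 tT] := t0T.
  have := diagonal_measure_itv n2 t0T levyX gaussX (PhiP 2%N isT) (PhiP n n1) phiX.
  have := phiE 0 t (lexx _) t0 tT; apply: filterS2 => w -> ->.
  by rewrite levy_variation0// subr0.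
Qed.
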